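(* In the setting and notation of the context, fix a parameter $\lambda>0$. Then there exists $R_\lambda=R_\lambda(m_i,H,J)>0$ such that any orbit (with energy $H<0$ and angular momentum $J$) with initial condition satisfying $I(0)\ge R_\lambda$ comes, in forwards or backwards time, into the region $\{I\le R_\lambda\}$. Explicitly, for orbits with initial condition in the component $B_3$, one may take $$\overline R_\lambda=\max\left\{R,\ \ \alpha_1c_r^2+\alpha_2\Big(\frac{\alpha_2A_1^2}{\lambda}\Big),\ \ 2\alpha_2A_1+4\alpha_1c_r^2+\lambda\right\},\qquad R_\lambda=\overline R_\lambda+2\alpha_2A_1+\lambda .$$
   Context: Spatial Newtonian three-body problem (gravitational constant $1$) with masses $m_1,m_2,m_3>0$, positions $q_i\in\mathbb{R}^3$, $\sum m_iq_i=0$, $\sum m_i\dot q_i=0$, at fixed energy $H=\frac12\sum_i m_i|\dot q_i|^2-\sum_{i<j}m_im_j/|q_i-q_j|<0$ and fixed angular momentum $J=\sum m_i\,q_i\times\dot q_i\in\mathbb{R}^3$. Orbits with binary collisions are either excluded or continued by Levi-Civita regularization. Jacobi coordinates: $\xi_1=q_2-q_1$, $\xi_2=q_3-(m_1q_1+m_2q_2)/(m_1+m_2)$, $r=|\xi_1|$, $\rho=|\xi_2|$. Mass constants: $\mu=m_1+m_2$, $M=m_1+m_2+m_3$, $\alpha_1=m_1m_2/\mu$, $\alpha_2=m_3\mu/M$, $\beta_1=\mu\alpha_1$, $\beta_2=M\alpha_2$. Then $I:=\sum m_i|q_i|^2=\alpha_1r^2+\alpha_2\rho^2$, $J=J_1+J_2$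 with $J_i=\alpha_i\,\xi_i\times\dot\xi_i$, and the energy is $\frac12\alpha_1|\dot\xi_1|^2-\frac{\beta_1}{r}+\frac12\alpha_2|\dot\xi_2|^2-\frac{\beta_2}{\rho}+g$ with $$g=\frac{\beta_2}{\rho}-\frac{m_1m_3}{|\xi_2+m_2\mu^{-1}\xi_1|}-\frac{m_2m_3}{|\xi_2-m_1\mu^{-1}\xi_1|}.$$ The equations of motion are $\alpha_i\ddot\xi_i=-\beta_i\xi_i/|\xi_i|^3-g_{\xi_i}$, $i=1,2$, where $g_{\xi_i}=\partial g/\partial\xi_i$. Constants: $I^*,c_g,c_{g_2},c_{J_2},c_r>0$ are constants depending only on the masses, $H$ and $J$, such that at these energy and angular momentum levels the region $\{I>I^*\}$ consists of three connected components, where the $k$-th one is that in which $q_k$ is the body far from the close pair formed by the other two, and such that throughout the third component, denoted $B_3$, the bounds $|g|\le c_g r^2/\rho^3$, $|g_{\xi_2}|\le c_{g_2}r^2/\rho^4$, $|J_2|\le\alpha_2c_{J_2}$ and $r\le c_r$ hold. (Such constants exist; the other components are treated by relabeling the masses and using the corresponding Jacobi coordinates and constants.) Further, $$I^{**}=\max\{I^*,\ \alpha_1c_r^2+\alpha_2c_{J_2}^4/M^2\},\qquad \overline R=\max\Big\{I^*,\ \alpha_1c_r^2+\max\{1,(\tfrac{3c_{J_2}^2}{2M})^2\}\alpha_2\Big\},\qquad R=\max\{\overline R,\ I^{**},\ 4\alpha_1c_r^2\},$$ and, with $B_1=2^{3/2}\pi/\sqrt M$: $A=\alpha_2^{-1}c_{g_2}c_r^2$,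 $a=(AB_1)^2+2c_{J_2}AB_1+A$, $A_1=\frac{a}{M}\big(2+e^{\sqrt{2M+3c_{J_2}^2}\,B_1}\big)$. *)

(* Defs.v *)
(* MathComp-Analysis *)
From mathcomp Require Import all_boot all_order all_algebra.
From mathcomp Require Import all_classical all_reals all_analysis.

Set Implicit Arguments.
Unset Strict Implicit.
Unset Printing Implicit Defensive.

Import Order.TTheory GRing.Theory Num.Theory numFieldNormedType.Exports.

Local Open Scope classical_set_scope.
Local Open Scope ring_scope.

(* The norm `|_| of 'rV_3 in the library is the sup norm, hence [enorm]; the
   topology is the same. *)
Definition dotv (R : realType) (x y : 'rV[R]_3) : R := \sum_i x 0 i * y 0 i.

Definition enorm (R : realType) (x : 'rV[R]_3) : R := Num.sqrt (dotv x x).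

(* Indices are added modulo 3, in the ring 'I_3. *)
Definition crossv (R : realType) (x y : 'rV[R]_3) : 'rV[R]_3 :=
  \row_(k < 3) (x 0 (k + 1) * y 0 (k + 2) - x 0 (k + 2) * y 0 (k + 1)).

Definition grad (R : realType) (f : 'rV[R]_3 -> R) (x : 'rV[R]_3) : 'rV[R]_3 :=
  \row_(i < 3) 'D_(delta_mx 0 i : 'rV[R]_3) f x.

Definition b1 : 'I_3 := @Ordinal 3 0 isT.
Definition b2 : 'I_3 := @Ordinal 3 1 isT.
Definition b3 : 'I_3 := @Ordinal 3 2 isT.

(* A configuration (or a triple of velocities) is a 3 x 3 matrix whose i-th row
   belongs to the body i; a state is a pair (positions, velocities). *)

Section ThreeBody.
Context (R : realType) (m : 'I_3 -> R).
Implicit Types (x v : 'M[R]_3) (s : 'M[R]_3 * 'M[R]_3).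
Implicit Types (i j k : 'I_3).

Definition dist x i j : R := enorm (row j x - row i x).

Definition collision_free x : Prop := forall i j, i != j -> row i x != row j x.

(* Two bodies coincide and the body [k] is elsewhere. *)
Definition binary_collision k x : Prop :=
  (forall i j, i != k -> j != k -> row i x = row j x) /\
  (forall i, i != k -> row i x != row k x).

Definition accel x : 'M[R]_3 :=
  \matrix_(i < 3)
    \sum_(j < 3 | j != i) (m j / dist x i j ^+ 3) *: (row j x - row i x).

Definition energy s : R :=
  2^-1 * (\sum_i m i * enorm (row i s.2) ^+ 2)
  - \sum_(i < 3) \sum_(j < 3 | (i < j)%N) m i * m j / dist s.1 i j.

Definition angmom s : 'rV[R]_3 :=
  \sum_i m i *: crossv (row i s.1) (row i s.2).

Definition inertia x : R := \sum_i m i * enorm (row i x) ^+ 2.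

Definition level (H : R) (J : 'rV[R]_3) : set ('M[R]_3 * 'M[R]_3) :=
  [set s | [/\ collision_free s.1,
               \sum_i m i *: row i s.1 = 0,
               \sum_i m i *: row i s.2 = 0,
               energy s = H & angmom s = J]].

(* Levi-Civita continuation of a binary collision of the two bodies other than
   [k] at time [t]. In the regularizing variable z, with z^2 = q_j - q_i, the
   motion crosses z = 0 smoothly and with nonzero speed, so the pair bounces:
   the direction of q_j - q_i has the same limit on both sides. The body [k],
   hence also the center of mass of the pair, moves with continuous velocity.
   Together with the conservation of energy this determines the outgoing motion
   from the incoming one. *)
Definition regularized_collision (q v : R -> 'M[R]_3) k (t : R) : Prop :=
  [/\ binary_collision k (q t),
      (\forall s \near t^', collision_free (q s)),
      q s @[s --> t] --> q t,
      cvg (row k (v s) @[s --> t^']) &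
      forall i j, i != k -> j != k -> i != j ->
        cvg ((enorm (row j (q s) - row i (q s)))^-1
               *: (row j (q s) - row i (q s)) @[s --> t^'])].

(* A motion cannot stop, at a finite time, at a regular state (where Newton's
   flow continues it) nor at a binary collision (which is either excluded or
   continued by regularization). [F] is the filter of one-sided neighborhoods of
   an endpoint. *)
Definition not_continuable (q v : R -> 'M[R]_3) (F : set_system R) : Prop :=
  ~ (exists x w : 'M[R]_3,
       [/\ collision_free x, q t @[t --> F] --> x & v t @[t --> F] --> w]) /\
  ~ (exists k (x : 'M[R]_3), binary_collision k x /\ q t @[t --> F] --> x).

(* An orbit (q, v) on its maximal time interval ]a, b[, with isolated and
   regularized binary collisions; collision-free orbits are the particular case
   in which the second alternative never occurs. The value of [v] at a collision
   time is irrelevant. *)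
Definition three_body_orbit (H : R) (J : 'rV[R]_3) (a b : \bar R) (q v : R -> 'M[R]_3) :
    Prop :=
  [/\ (a < 0%:E)%E /\ (0%:E < b)%E,
      forall t : R, (a < t%:E)%E -> (t%:E < b)%E ->
        [/\ level H J (q t, v t), is_derive t 1 q (v t)
          & is_derive t 1 v (accel (q t))]
        \/ (exists k, regularized_collision q v k t),
      forall e : R, b = e%:E -> not_continuable q v (e^'-)
    & forall e : R, a = e%:E -> not_continuable q v (e^'+)].

Definition region (H : R) (J : 'rV[R]_3) (Istar : R) :
    set ('M[R]_3 * 'M[R]_3) :=
  [set s | level H J s /\ Istar < inertia s.1].

(* The part of the region in which [k] is far from the close pair formed by the
   other two bodies. *)
Definition component (H : R) (J : 'rV[R]_3) (Istar : R) k :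
    set ('M[R]_3 * 'M[R]_3) :=
  [set s | region H J Istar s /\
           forall i j, i != k -> j != k -> i != j ->
             dist s.1 i j < dist s.1 i k].

Definition three_components (H : R) (J : 'rV[R]_3) (Istar : R) : Prop :=
  region H J Istar = \bigcup_k component H J Istar k /\
  forall k, component H J Istar k !=set0 /\
    forall s, component H J Istar k s ->
      connected_component (region H J Istar) s = component H J Istar k.

Definition mu : R := m b1 + m b2.
Definition Mtot : R := m b1 + m b2 + m b3.
Definition alpha1 : R := m b1 * m b2 / mu.
Definition alpha2 : R := m b3 * mu / Mtot.
Definition beta1 : R := mu * alpha1.
Definition beta2 : R := Mtot * alpha2.

(* Being linear, these also give the velocities of the Jacobi vectors. *)
Definition xi1 x : 'rV[R]_3 := row b2 x - row b1 x.
Definition xi2 x : 'rV[R]_3 :=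
  row b3 x - mu^-1 *: (m b1 *: row b1 x + m b2 *: row b2 x).

Definition gpert (y1 y2 : 'rV[R]_3) : R :=
  beta2 / enorm y2
  - m b1 * m b3 / enorm (y2 + (m b2 / mu) *: y1)
  - m b2 * m b3 / enorm (y2 - (m b1 / mu) *: y1).

Definition J2 s : 'rV[R]_3 := alpha2 *: crossv (xi2 s.1) (xi2 s.2).

Record constants := Constants {
  Istar : R; c_g : R; c_g2 : R; c_J2 : R; c_r : R }.

Definition admissible (H : R) (J : 'rV[R]_3) (c : constants) : Prop :=
  [/\ [/\ 0 < Istar c, 0 < c_g c, 0 < c_g2 c, 0 < c_J2 c & 0 < c_r c],
      three_components H J (Istar c)
    & forall s, component H J (Istar c) b3 s ->
        let r := enorm (xi1 s.1) in
        let rho := enorm (xi2 s.1) in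
        [/\ `|gpert (xi1 s.1) (xi2 s.1)| <= c_g c * r ^+ 2 / rho ^+ 3,
            enorm (grad (gpert (xi1 s.1)) (xi2 s.1))
              <= c_g2 c * r ^+ 2 / rho ^+ 4,
            enorm (J2 s) <= alpha2 * c_J2 c
          & r <= c_r c]].

(* The initial condition is in the component of [k]. For a collision-free
   initial state this is [component H J Istar k (q 0, v 0)], since the component
   is relatively open in the level; the punctured neighborhood gives the
   meaning at a regularized initial collision. *)
Definition starts_in_component (H : R) (J : 'rV[R]_3) (Is : R) k
    (q v : R -> 'M[R]_3) : Prop :=
  \forall t \near (0 : R)^', component H J Is k (q t, v t).

Section Radii.
Context (c : constants) (lambda : R).

Definition Iss : R :=
  Num.max (Istar c)
    (alpha1 * c_r c ^+ 2 + alpha2 * c_J2 c ^+ 4 / Mtot ^+ 2).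

Definition Rbar : R :=
  Num.max (Istar c)
    (alpha1 * c_r c ^+ 2
     + Num.max 1 ((3 * c_J2 c ^+ 2 / (2 * Mtot)) ^+ 2) * alpha2).

Definition Rmain : R :=
  Num.max Rbar (Num.max Iss (4 * alpha1 * c_r c ^+ 2)).

Definition cB1 : R := 2 `^ (3 / 2) * pi / Num.sqrt Mtot.
Definition cA : R := alpha2^-1 * c_g2 c * c_r c ^+ 2.
Definition ca : R := (cA * cB1) ^+ 2 + 2 * c_J2 c * cA * cB1 + cA.
Definition cA1 : R :=
  ca / Mtot * (2 + expR (Num.sqrt (2 * Mtot + 3 * c_J2 c ^+ 2) * cB1)).

Definition Rbar_lambda : R :=
  Num.max Rmain
    (Num.max (alpha1 * c_r c ^+ 2 + alpha2 * (alpha2 * cA1 ^+ 2 / lambda))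
             (2 * alpha2 * cA1 + 4 * alpha1 * c_r c ^+ 2 + lambda)).

Definition R_lambda : R := Rbar_lambda + 2 * alpha2 * cA1 + lambda.
End Radii.

End ThreeBody.

(* Main.v *)
(** Suppose that I > R_lambda along a whole orbit. Then one body k stays far from
the close pair (i, j) formed by the other two, and its distance p to the center
of mass satisfies p'' < 0: the attraction of the pair, of order 1/p^2, dominates
the centrifugal term |J_2|^2/p^3. A positive strictly concave function does not
exist on the whole line, so the orbit has a finite endpoint. There the motion of
k converges, its acceleration being bounded, and by the Lagrange-Jacobi identity
the second derivative of |q_j - q_i|^2 is bounded below across the regularized
collisions; hence |q_j - q_i| converges. According to its limit, the
configuration tends to a binary collision or the state tends to a regular one,
and neither is the end of a maximal orbit. *)
Require Import Defs.
From mathcomp Require Import all_boot all_order all_algebra.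
From mathcomp Require Import all_classical all_reals all_analysis.
From mathcomp Require Import ring lra.
Import Order.TTheory GRing.Theory Num.Theory numFieldNormedType.Exports.

Set Implicit Arguments.
Unset Strict Implicit.
Unset Printing Implicit Defensive.

Local Open Scope classical_set_scope.
Local Open Scope ring_scope.

(** * Functions differentiable off isolated points *)

(** The velocity has no meaning at a collision, and the relative velocity of the pair is unbounded
    there. Every monotonicity argument is therefore carried by functions such as p' and (r^2)', with
    r the distance of the pair, which have a limit at each collision: p' because the velocity of k
    has one, (r^2)' because it is O(sqrt r) on the energy level. Body k is the one opposite to the
    shortest side. This choice is unique and locally constant in time, collisions included, hence
    constant along the orbit. The inequality p'' < 0 is checked twice. For an unspecified radius, H
    bounds the shortest side, H and J then bound the angular momentum of k, and a large p does the
    rest. For the explicit radius, rho = |xi_2| > 3 c_J2^2 / (2 M) makes the centrifugal term less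
    than two thirds of the attraction M / rho^2, and rho^2 > 4 A_1 makes the perturbation less than
    the remaining third. Only endpoints on the right are studied; those on the left follow by
    reversal of time. *)

Lemma interval_transP {R : realType} (P : R -> R -> Prop) (s t : R) :
  (forall x, P x x) -> (forall x y z, P x y -> P y z -> P x z) ->
  (forall r, s <= r <= t ->
     \forall x \near r, (x < r -> P x r) /\ (r < x -> P r x)) ->
  s <= t -> P s t.
Proof.
move=> Prefl Ptrans Ploc st.
(* The left half of the local hypothesis at [sup S] puts [sup S] in [S]; the right half then
   excludes [sup S < t]. *)
pose S := [set z | s <= z <= t /\ P s z].
have Ss : S s by split=> //; rewrite lexx.
have hS : has_sup S.
  by split; [exists s | exists t => z [/andP[]]].
have sS : s <= sup S by apply: ub_le_sup => //; exact: hS.2.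
have St : sup S <= t by apply: ge_sup; [exists s | move=> z [/andP[]]].
have := Ploc (sup S); rewrite sS St => /(_ isT)/nbhs_ballP[e/= e0 He].
have PS : P s (sup S).
  have [x Sx xe] := sup_adherent e0 hS.
  have xS : x <= sup S by apply: ub_le_sup => //; exact: hS.2.
  move: xS; rewrite le_eqVlt => /predU1P[<-|xS]; first exact: Sx.2.
  apply: Ptrans Sx.2 _; apply: (He x _).1 => //.
  by rewrite /ball/= ger0_norm; lra.
move: St; rewrite le_eqVlt => /predU1P[<- //|St].
pose x := Num.min t (sup S + e / 2).
have Sx : sup S < x by rewrite lt_min St /=; lra.
have Hx : P (sup S) x.
  apply: (He x _).2 => //; rewrite /ball/= ltr0_norm; last lra.
  have : x <= sup S + e / 2 by rewrite ge_min lexx orbT.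
  lra.
have : x <= sup S.
  apply: ub_le_sup; first exact: hS.2.
  split; last exact: Ptrans PS Hx.
  by rewrite ge_min lexx /= andbT; lra.
lra.
Qed.

Section Piecewise.
Context {R : realType}.
Implicit Types (g dg : R -> R) (r s t : R).

Lemma dnbhs_between (a b r : R) : a < r -> r < b ->
  \forall x \near r^', a < x /\ x < b.
Proof.
move=> ar rb; apply: nbhs_dnbhs; near=> x.
by split; near: x; [exact: lt_nbhsr | exact: lt_nbhsl].
Unshelve. all: by end_near. Qed.

(* The continuous extension of [g] across its removable singularities. *)
Definition ext g t : R := lim (g s @[s --> t^']).

(** Required at every point of an interval, this makes the exceptional points isolated and leaves
    the value of [g] there arbitrary, as for velocities at collisions. *)
Definition piecewise_derive g dg t : Prop :=
  cvg (g s @[s --> t^']) /\ \forall s \near (t : R)^', is_derive (s : R) (1 : R) g (dg s).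

Lemma is_derive_continuous (f : R -> R) (x df : R) :
  is_derive x 1 f df -> {for x, continuous f}.
Proof.
by move=> [df1 _]; apply: differentiable_continuous; exact/derivable1_diffP.
Qed.

Lemma ext_continuous g t : {for t, continuous g} -> ext g t = g t.
Proof. by move=> /continuous_withinNx gt; exact: cvg_lim gt. Qed.

Lemma ext_near g dg t : piecewise_derive g dg t ->
  \forall s \near t^', ext g s = g s.
Proof.
case=> _; apply: filterS => s gs.
exact: (ext_continuous (is_derive_continuous gs)).
Qed.

Lemma cvg_ext g dg t : piecewise_derive g dg t ->
  g s @[s --> t^'] --> ext g t.
Proof. by case. Qed.

(** A mean value inequality across isolated singularities. The relation ext g x + C (y - x) <= ext g
    y is transitive, so it suffices to compare r with a nearby x; the mean value theorem applies
    between x and a point y on the same side of r, and then y tends to r. *)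
Lemma piecewise_derive_mono g dg (C s t : R) : s <= t ->
  (forall r, s <= r <= t -> piecewise_derive g dg r /\
     \forall x \near r^', C <= dg x) ->
  ext g s + C * (t - s) <= ext g t.
Proof.
move=> st H; apply: (interval_transP (P := fun x y => ext g x + C * (y - x) <= ext g y)) st => //.
- by move=> x; rewrite subrr mulr0 addr0.
- by move=> x y z xy yz; apply: le_trans yz; nra.
move=> r /H[pr Cr].
have : \forall x \near r^', [/\ is_derive (x : R) (1 : R) g (dg x), C <= dg x & ext g x = g x].
  by near=> x; split; near: x; [exact: pr.2 | exact: Cr | exact: ext_near pr].
rewrite near_withinE => /nbhs_ballP[e/= e0 He].
have mvt x y : ball r e x -> ball r e y -> x < y ->
    (forall z, x <= z <= y -> z != r) -> g x + C * (y - x) <= g y.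
  move=> xe ye xy xyr.
  have Hz z : x <= z <= y -> [/\ is_derive z 1 g (dg z), C <= dg z & ext g z = g z].
    move=> zxy; apply: He (xyr _ zxy).
    move: xe ye zxy; rewrite /ball/= !ltr_norml; lra.
  have [z zxy gxy] : exists2 c, c \in `]x, y[%R & g y - g x = dg c * (y - x).
    apply: MVT => // [z|].
      by rewrite in_itv/= => /andP[xz zy]; have [|//] := Hz z; rewrite !ltW.
    apply: continuous_in_subspaceT => z; rewrite inE/= in_itv/= => /Hz[gz _ _].
    exact: is_derive_continuous gz.
  have [|_ Cz _] := Hz z.
    by move: zxy; rewrite in_itv/= => /andP[xz zy]; rewrite !ltW.
  have : C * (y - x) <= dg z * (y - x) by rewrite ler_wpM2r// subr_ge0 ltW.
  lra.
near=> x.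
have xe : ball r e x by near: x; apply/nbhs_ballP; exists e.
split=> xr; have nxr : x != r by rewrite ?(lt_eqF xr) ?(gt_eqF xr).
- have [_ _ ->] := He x xe nxr.
  have cg : g y @[y --> r^'-] --> ext g r by apply: cvg_dnbhs_at_left; exact: cvg_ext pr.
  have cl : g x + C * (y - x) @[y --> r^'-] --> g x + C * (r - x).
    apply: cvgD; first exact: cvg_cst.
    apply: cvgMr; apply: cvgB; last exact: cvg_cst.
    exact: cvg_at_left_filter.
  apply: ler_cvg_to cl cg _.
  near=> y; have [xy yr] : x < y /\ y < r.
    by split; near: y; [exact: nbhs_left_gt | exact: nbhs_left_lt].
  apply: mvt => //.
  + by move: xe; rewrite /ball/= !ltr_norml; lra.
  + by move=> z /andP[xz zy]; rewrite lt_eqF//; lra.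
- have [_ _ ->] := He x xe nxr.
  have cg : g y @[y --> r^'+] --> ext g r by apply: cvg_dnbhs_at_right; exact: cvg_ext pr.
  have cl : g y + C * (x - y) @[y --> r^'+] --> ext g r + C * (x - r).
    apply: cvgD; first exact: cg.
    apply: cvgMr; apply: cvgB; first exact: cvg_cst.
    exact: cvg_at_right_filter.
  apply: ler_cvg_to cl (cvg_cst _) _.
  near=> y; have [xy yr] : r < y /\ y < x.
    by split; near: y; [exact: nbhs_right_gt | exact: nbhs_right_lt].
  apply: mvt => //.
  + by move: xe; rewrite /ball/= !ltr_norml; lra.
  + by move=> z /andP[xz zy]; rewrite gt_eqF//; lra.
Unshelve. all: by end_near. Qed.

Lemma piecewise_deriveN g dg t : piecewise_derive g dg t ->
  piecewise_derive (\- g) (\- dg) t /\ ext (\- g) t = - ext g t.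
Proof.
move=> pg;
have cN : (\- g) s @[s --> t^'] --> - ext g t by apply: cvgN; exact: cvg_ext pg.
split.
  split; first by apply/cvg_ex; eexists; exact: cN.
  by apply: filterS pg.2 => s ?; exact: is_deriveN.
exact: cvg_lim.
Qed.

Lemma piecewise_derive_mono_le g dg (C s t : R) : s <= t ->
  (forall r, s <= r <= t -> piecewise_derive g dg r /\
     \forall x \near r^', dg x <= C) ->
  ext g t <= ext g s + C * (t - s).
Proof.
move=> st H.
have := @piecewise_derive_mono (\- g) (\- dg) (- C) s t st.
have [_ ->] : piecewise_derive (\- g) (\- dg) s /\ ext (\- g) s = - ext g s.
  by apply: piecewise_deriveN; apply: (H s _).1; rewrite lexx.
have [_ ->] : piecewise_derive (\- g) (\- dg) t /\ ext (\- g) t = - ext g t.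
  by apply: piecewise_deriveN; apply: (H t _).1; rewrite lexx st.
move=> h; suff : - ext g s + - C * (t - s) <= - ext g t by lra.
apply: h => r /H[pr Cr]; split; first by have [] := piecewise_deriveN pr.
by apply: filterS Cr => x; rewrite lerN2.
Qed.

Lemma nondecreasing_bounded_cvg_left (f : R -> R) (t0 e B : R) : t0 < e ->
  (forall s t, t0 <= s -> s <= t -> t < e -> f s <= f t) ->
  (forall s, t0 <= s -> s < e -> f s <= B) -> cvg (f s @[s --> e^'-]).
Proof.
move=> t0e fmono fB; apply: nondecreasing_at_left_is_cvgr.
  near=> x => s t; rewrite !in_itv/= => /andP[xs se] /andP[xt te] st.
  apply: fmono => //; apply: le_trans (ltW xs).
  by near: x; exact: nbhs_left_ge.
near=> x; exists B => _ [y /= + <-]; rewrite in_itv/= => /andP[xy ye].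
apply: fB => //; apply: le_trans (ltW xy).
by near: x; exact: nbhs_left_ge.
Unshelve. all: by end_near. Qed.

Lemma piecewise_lipschitz_bounded g dg (C t0 e : R) : t0 < e ->
  (forall r, t0 <= r -> r < e -> piecewise_derive g dg r /\
     \forall x \near r^', `|dg x| <= C) ->
  forall s, t0 <= s -> s < e -> `|ext g s| <= `|ext g t0| + C * (e - t0).
Proof.
move=> t0e H s t0s se.
have C0 : 0 <= C.
  have [_ H0] := H t0 (lexx _) t0e.
  near t0^' => x; apply: (@le_trans _ _ `|dg x|) => //.
  by near: x; exact: H0.
have lo : ext g t0 + - C * (s - t0) <= ext g s.
  apply: (@piecewise_derive_mono g dg) => // r /andP[t0r rs].
  have [pr Cr] := H r t0r (le_lt_trans rs se); split=> //.
  by apply: filterS Cr => x; rewrite ler_norml => /andP[].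
have up : ext g s <= ext g t0 + C * (s - t0).
  apply: (@piecewise_derive_mono_le g dg) => // r /andP[t0r rs].
  have [pr Cr] := H r t0r (le_lt_trans rs se); split=> //.
  by apply: filterS Cr => x; rewrite ler_norml => /andP[].
have Ce : C * (s - t0) <= C * (e - t0) by rewrite ler_wpM2l//; lra.
have := ler_norm (ext g t0); have := lerNnormlW (lexx `|ext g t0|).
rewrite ler_norml; lra.
Unshelve. all: by end_near. Qed.

(** Adding C s to [ext g] makes it nondecreasing while it stays bounded, so monotone convergence
    applies. *)
Lemma piecewise_lipschitz_cvg_left g dg (C t0 e : R) : t0 < e ->
  (forall r, t0 <= r -> r < e -> piecewise_derive g dg r /\
     \forall x \near r^', `|dg x| <= C) ->
  cvg (ext g s @[s --> e^'-]).
Proof.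
move=> t0e H.
have C0 : 0 <= C.
  have [_ H0] := H t0 (lexx _) t0e.
  near t0^' => x; apply: (@le_trans _ _ `|dg x|) => //.
  by near: x; exact: H0.
have cE : cvg (ext g s + C * s @[s --> e^'-]).
  apply: (@nondecreasing_bounded_cvg_left _ t0 e
           (`|ext g t0| + C * (e - t0) + C * e)) => // [s t t0s st te|s t0s se].
    suff : ext g s + - C * (t - s) <= ext g t by lra.
    apply: (@piecewise_derive_mono g dg) => // r /andP[sr rt].
    have [pr Cr] := H r (le_trans t0s sr) (le_lt_trans rt te); split=> //.
    by apply: filterS Cr => x; rewrite ler_norml => /andP[].
  apply: lerD; last by rewrite ler_wpM2l// ltW.
  exact: le_trans (ler_norm _) (piecewise_lipschitz_bounded t0e H t0s se).
have cC : C * s @[s --> e^'-] --> C * e.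
  by apply: cvgMr; exact: cvg_at_left_filter.
have -> : ext g = (fun s => ext g s + C * s - C * s) by apply/funext => s; lra.
by apply: is_cvgB => //; apply/cvg_ex; eexists; exact: cC.
Unshelve. all: by end_near. Qed.

Lemma lipschitz_cvg_left g dg (C t0 e : R) : t0 < e ->
  (forall r, t0 <= r -> r < e ->
     [/\ {for r, continuous g}, piecewise_derive g dg r
       & \forall x \near r^', `|dg x| <= C]) ->
  cvg (g s @[s --> e^'-]).
Proof.
move=> t0e H.
have /cvg_ex[/= l gl] : cvg (ext g s @[s --> e^'-]).
  apply: (@piecewise_lipschitz_cvg_left g dg C t0 e) => // r t0r re.
  by have [] := H r t0r re.
apply/cvg_ex; exists l; apply: cvg_trans gl; apply: near_eq_cvg; near=> s.
have [] := H s; last by move=> gs _ _; exact: ext_continuous.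
  by near: s; exact: nbhs_left_ge.
by near: s; exact: nbhs_left_lt.
Unshelve. all: by end_near. Qed.

(* [D x + C (x - t0)] is nondecreasing: either it becomes nonnegative and then
   [phi x + C (e - t0) x] is nondecreasing, or [phi] is nonincreasing. *)
Lemma semiconvex_bounded_cvg_left (phi D dD : R -> R) (C B t0 e : R) :
  t0 < e -> 0 <= C ->
  (forall r, t0 <= r -> r < e -> {for r, continuous phi}) ->
  (forall r, t0 <= r -> r < e -> 0 <= phi r <= B) ->
  (forall r, t0 <= r -> r < e -> piecewise_derive phi D r) ->
  (forall r, t0 <= r -> r < e -> piecewise_derive D dD r /\
     \forall x \near r^', - C <= dD x) ->
  cvg (phi s @[s --> e^'-]).
Proof.
move=> t0e C0 phic phiB pphi pD.
have Dmono s t : t0 <= s -> s <= t -> t < e -> ext D s + - C * (t - s) <= ext D t.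
  move=> s0 st te; apply: (@piecewise_derive_mono D dD) => // r /andP[sr rt].
  exact: pD (le_trans s0 sr) (le_lt_trans rt te).
have phiE r : t0 <= r -> r < e -> ext phi r = phi r.
  by move=> r0 re; exact/ext_continuous/phic.
have [[t1 [t01 t1e Dt1]]|noD] :=
    pselect (exists t1, [/\ t0 <= t1, t1 < e & 0 <= ext D t1 + C * (t1 - t0)]).
  (* The lower bound - K for [D] holds to the right of t1. Starting at the midpoint t2 keeps a
     punctured neighborhood of every later point inside ]t1, e[. *)
  pose K := C * (e - t0); pose t2 := (t1 + e) / 2.
  have [t12 t2e] : t1 < t2 /\ t2 < e by rewrite /t2; lra.
  have t02 : t0 <= t2 by lra.
  have K0 : 0 <= K by rewrite mulr_ge0// subr_ge0 ltW.
  have cE : cvg (phi s + K * s @[s --> e^'-]).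
    apply: (@nondecreasing_bounded_cvg_left _ t2 e (B + K * e)) => //.
      move=> s t t2s st te; have t0s := le_trans t02 t2s.
      suff : ext phi s + - K * (t - s) <= ext phi t.
        by rewrite !phiE ?(le_trans t0s)// ?(le_lt_trans st)//; clear; lra.
      apply: (@piecewise_derive_mono phi D) => // r /andP[sr rt].
      have [t0r re] : t0 <= r /\ r < e by split; lra.
      split; first exact: pphi.
      have [pr _] := pD r t0r re.
      near=> x.
      have [xt1 xe] : t1 < x /\ x < e by near: x; apply: dnbhs_between; lra.
      have <- : ext D x = D x by near: x; exact: ext_near pr.
      have := Dmono t1 x t01 (ltW xt1) xe.
      have : C * (x - t0) <= K by rewrite ler_wpM2l// lerB// ltW.
      lra.
    move=> s ts se; apply: lerD.
      by have /andP[] // : 0 <= phi s <= B by apply: phiB; lra.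
    by rewrite ler_wpM2l// ltW.
  have cC : K * s @[s --> e^'-] --> K * e by apply: cvgMr; exact: cvg_at_left_filter.
  have -> : phi = (fun s => phi s + K * s - K * s).
    by apply/funext => s; rewrite addrK.
  by apply: is_cvgB => //; apply/cvg_ex; eexists; exact: cC.
have Dneg s : t0 <= s -> s < e -> ext D s <= 0.
  move=> s0 se; rewrite leNgt; apply/negP => Ds; apply: noD; exists s.
  by split=> //; rewrite addr_ge0 ?mulr_ge0 ?subr_ge0// ltW.
pose t2 := (t0 + e) / 2; have [t02 t2e] : t0 < t2 /\ t2 < e by rewrite /t2; lra.
have cN : cvg (- phi s @[s --> e^'-]).
  apply: (@nondecreasing_bounded_cvg_left _ t2 e 0) => // [s t t2s st te|s t2s se].
    have t0s := le_trans (ltW t02) t2s; rewrite lerN2.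
    suff : ext phi t <= ext phi s + 0 * (t - s).
      by rewrite !phiE ?(le_trans t0s)// ?(le_lt_trans st)// mul0r addr0.
    apply: (@piecewise_derive_mono_le phi D) => // r /andP[sr rt].
    have [t0r re] : t0 < r /\ r < e by split; lra.
    split; first by apply: pphi => //; exact: ltW.
    have [pr _] := pD r (ltW t0r) re.
    near=> x.
    have <- : ext D x = D x by near: x; exact: ext_near pr.
    have [x0 xe] : t0 < x /\ x < e by near: x; exact: dnbhs_between.
    by apply: Dneg => //; exact: ltW.
  by rewrite oppr_le0; have /andP[] // : 0 <= phi s <= B by apply: phiB; lra.
have -> : phi = (fun s => - - phi s) by apply/funext => s; rewrite opprK.
exact: is_cvgN.
Unshelve. all: by end_near. Qed.

(** The derivative is nonincreasing, so a nonzero value of it at some t would bring p down to 0 on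
    one side, below a line of that slope. Hence it vanishes identically, against [du s < 0]. *)
Lemma strictly_concave_not_positive (p u du : R -> R) :
  (forall t, 0 < p t) -> (forall t, {for t, continuous p}) ->
  (forall t, piecewise_derive p u t) ->
  (forall t, piecewise_derive u du t /\ \forall s \near t^', du s < 0) -> False.
Proof.
move=> p0 pc pp pu.
have umono s t : s <= t -> ext u t <= ext u s.
  move=> st; suff : ext u t <= ext u s + 0 * (t - s) by lra.
  apply: (@piecewise_derive_mono_le u du) => // r _; have [pr dr] := pu r.
  by split=> //; apply: filterS dr => x /ltW.
have pE t : ext p t = p t by exact: ext_continuous.
have uE r : \forall s \near r^', ext u s = u s by apply: ext_near (pu r).1.
have u_le0 t : ext u t <= 0.
  rewrite leNgt; apply/negP => ut.
  (* The zero of the line of slope [ext u t] through the point of the graph of p at t - 1. The shift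
     by 1 keeps punctured neighborhoods of the points up to t - 1 on the left of t, where the
     derivative is at least [ext u t]. *)
  pose s := t - 1 - p (t - 1) / ext u t.
  have st : s <= t - 1 by rewrite /s; have := divr_gt0 (p0 (t - 1)) ut; lra.
  have := @piecewise_derive_mono p u (ext u t) s (t - 1) st.
  rewrite !pE => h.
  have {}h : p s + ext u t * (t - 1 - s) <= p (t - 1).
    apply: h => r /andP[sr rt]; split=> //; near=> x.
    have <- : ext u x = u x by near: x; exact: uE.
    apply: umono; apply: ltW.
    have [//] : s - 1 < x /\ x < t by near: x; apply: dnbhs_between; lra.
  have := p0 s; move: h; rewrite /s opprB addrA.
  rewrite (_ : t - 1 + _ - _ = p (t - 1) / ext u t); last by ring.
  by rewrite mulrCA divff ?gt_eqF// mulr1; lra.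
have u_ge0 t : 0 <= ext u t.
  rewrite leNgt; apply/negP => ut.
  pose s := t + 1 - p (t + 1) / ext u t.
  have st : t + 1 <= s.
    rewrite /s; have := @divr_gt0 _ (p (t + 1)) (- ext u t) (p0 _).
    rewrite invrN mulrN; lra.
  have := @piecewise_derive_mono_le p u (ext u t) (t + 1) s st.
  rewrite !pE => h.
  have {}h : p s <= p (t + 1) + ext u t * (s - (t + 1)).
    apply: h => r /andP[sr rt]; split=> //; near=> x.
    have <- : ext u x = u x by near: x; exact: uE.
    apply: umono; apply: ltW.
    have [//] : t < x /\ x < s + 1 by near: x; apply: dnbhs_between; lra.
  have := p0 s; move: h; rewrite /s.
  rewrite (_ : t + 1 - _ - _ = - (p (t + 1) / ext u t)); last by ring.
  by rewrite mulrN mulrCA divff ?lt_eqF// mulr1; lra.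
have u0 t : ext u t = 0 by apply/eqP; rewrite eq_le u_le0 u_ge0.
have := filterI (pu 0).1.2 (pu 0).2.
(* Only [ext u] is known to vanish. It agrees with [u] off isolated points, hence on a full
   neighborhood of each s close to 0 and different from it; there [u] has derivative 0. *)
have u0' : \forall s \near 0^', \forall x \near s, u x = 0.
  have := uE 0; rewrite near_withinE => /nbhs_interior h.
  rewrite near_withinE; near=> s => s0.
  have : \forall x \near s, x != 0 -> ext u x = u x by near: s; exact: h.
  move=> hs; near=> x; rewrite -(u0 x); apply/esym.
  have: x != 0 by near: x; exact: open_neq.
  by near: x.
move=> h; have [s [us [dus dus0]]] := filter_ex (filterI u0' (h _)).
have : is_derive s 1 u 0.
  by apply: (near_eq_is_derive (f := cst 0)) => //; near=> x; apply/esym; near: x.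
move=> [_]; have [_ ->] := dus; move: dus0 => /[swap] ->; rewrite ltxx.
by [].
Unshelve. all: by end_near. Qed.

End Piecewise.

(** * Vectors *)

Section Vectors.
Context {R : realType}.
Implicit Types (x y z : 'rV[R]_3) (a : R).

Lemma dotvE x y : dotv x y =
  x 0 0 * y 0 0 + x 0 1 * y 0 1 + x 0 (1 + 1) * y 0 (1 + 1).
Proof.
rewrite /dotv !big_ord_recl big_ord0 addr0 addrA.
by congr (_ * _ + _ * _ + _ * _); congr (_ 0 _); apply/val_inj.
Qed.

Lemma dotvC x y : dotv x y = dotv y x.
Proof. by rewrite !dotvE; ring. Qed.

Lemma dotvDl x y z : dotv (x + y) z = dotv x z + dotv y z.
Proof. by rewrite !dotvE !mxE; ring. Qed.

Lemma dotvDr x y z : dotv z (x + y) = dotv z x + dotv z y.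
Proof. by rewrite !dotvE !mxE; ring. Qed.

Lemma dotvZl a x y : dotv (a *: x) y = a * dotv x y.
Proof. by rewrite !dotvE !mxE; ring. Qed.

Lemma dotvZr a x y : dotv x (a *: y) = a * dotv x y.
Proof. by rewrite !dotvE !mxE; ring. Qed.

Lemma dotvNl x y : dotv (- x) y = - dotv x y.
Proof. by rewrite !dotvE !mxE; ring. Qed.

Lemma dotvNr x y : dotv x (- y) = - dotv x y.
Proof. by rewrite !dotvE !mxE; ring. Qed.

Definition dotv_lin := (dotvDl, dotvDr, dotvZl, dotvZr, dotvNl, dotvNr).

Lemma dotv_ge0 x : 0 <= dotv x x.
Proof. by rewrite dotvE !addr_ge0// -expr2 sqr_ge0. Qed.

Lemma sqr_enorm x : enorm x ^+ 2 = dotv x x.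
Proof. by rewrite sqr_sqrtr// dotv_ge0. Qed.

Lemma enorm_ge0 x : 0 <= enorm x.
Proof. exact: sqrtr_ge0. Qed.

Lemma coord_le_enorm x (c : 'I_3) : `|x 0 c| <= enorm x.
Proof.
rewrite -sqrtr_sqr ler_wsqrtr// /dotv (bigD1 c)//= -expr2 lerDl.
by apply: sumr_ge0 => i _; rewrite -expr2 sqr_ge0.
Qed.

Lemma enorm_eq0 x : (enorm x == 0) = (x == 0).
Proof.
apply/idP/eqP => [/eqP x0|->]; last first.
  by rewrite /enorm dotvE !mxE !mul0r !addr0 sqrtr0.
apply/rowP => c; rewrite mxE; apply/eqP; rewrite -normr_le0 -x0.
exact: coord_le_enorm.
Qed.

Lemma enorm_gt0 x : (0 < enorm x) = (x != 0).
Proof. by rewrite lt0r enorm_eq0 enorm_ge0 andbT. Qed.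

Lemma enormZ a x : enorm (a *: x) = `|a| * enorm x.
Proof.
rewrite /enorm dotvZl dotvZr mulrA -expr2 sqrtrM ?sqr_ge0//.
by rewrite sqrtr_sqr.
Qed.

Lemma enormN x : enorm (- x) = enorm x.
Proof. by rewrite /enorm dotvNl dotvNr opprK. Qed.

Lemma enormB x y : enorm (x - y) = enorm (y - x).
Proof. by rewrite -enormN opprB. Qed.

(** Lagrange's identity. It yields the Cauchy-Schwarz inequality and brings the derivative of the
    radial velocity to the form [radial_force]. *)
Lemma dotv_crossv x y :
  enorm (crossv x y) ^+ 2 = dotv x x * dotv y y - dotv x y ^+ 2.
Proof.
rewrite sqr_enorm !dotvE !mxE.
have -> : (1 + 1 + 1 : 'I_3) = 0 by apply/val_inj.
have -> : (1 + 1 + 2 : 'I_3) = 1 by apply/val_inj.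
have -> : (1 + 2 : 'I_3) = 0 by apply/val_inj.
have -> : (0 + 1 : 'I_3) = 1 by apply/val_inj.
have -> : (0 + 2 : 'I_3) = 1 + 1 by apply/val_inj.
ring.
Qed.

Lemma enorm_crossv_le x y : enorm (crossv x y) <= enorm x * enorm y.
Proof.
rewrite -(ler_sqr (enorm_ge0 _)) ?nnegrE ?mulr_ge0 ?enorm_ge0//.
by rewrite exprMn dotv_crossv !sqr_enorm lerBlDr lerDl sqr_ge0.
Qed.

Lemma cauchy_schwarz x y : `|dotv x y| <= enorm x * enorm y.
Proof.
rewrite -ler_sqr ?nnegrE ?mulr_ge0 ?enorm_ge0//.
rewrite real_normK ?num_real// exprMn !sqr_enorm -subr_ge0 -dotv_crossv.
exact: sqr_ge0.
Qed.

Lemma ler_enormD x y : enorm (x + y) <= enorm x + enorm y.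
Proof.
rewrite -ler_sqr ?nnegrE ?addr_ge0 ?enorm_ge0//.
rewrite sqrrD !sqr_enorm !dotv_lin (dotvC y x).
have := le_trans (ler_norm _) (cauchy_schwarz x y).
lra.
Qed.

Lemma ler_enormB x y : enorm (x - y) <= enorm x + enorm y.
Proof. by rewrite -(enormN y) ler_enormD. Qed.

Lemma lerB_enormD x y : enorm x - enorm y <= enorm (x + y).
Proof. by have := ler_enormB (x + y) y; rewrite addrK; lra. Qed.

Lemma crossvDl x y z : crossv (x + y) z = crossv x z + crossv y z.
Proof. by apply/rowP => c; rewrite !mxE; ring. Qed.

Lemma crossvDr x y z : crossv z (x + y) = crossv z x + crossv z y.
Proof. by apply/rowP => c; rewrite !mxE; ring. Qed.

Lemma crossvZl a x y : crossv (a *: x) y = a *: crossv x y.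
Proof. by apply/rowP => c; rewrite !mxE; ring. Qed.

Lemma crossvZr a x y : crossv x (a *: y) = a *: crossv x y.
Proof. by apply/rowP => c; rewrite !mxE; ring. Qed.

Lemma crossvNl x y : crossv (- x) y = - crossv x y.
Proof. by apply/rowP => c; rewrite !mxE; ring. Qed.

Lemma crossvNr x y : crossv x (- y) = - crossv x y.
Proof. by apply/rowP => c; rewrite !mxE; ring. Qed.

Definition crossv_lin := (crossvDl, crossvDr, crossvZl, crossvZr, crossvNl, crossvNr).

End Vectors.

Lemma ord3_distinct (i j k l : 'I_3) : i != j -> i != k -> j != k ->
  [\/ l = i, l = j | l = k].
Proof.
move=> ij ik jk; suff : [|| l == i, l == j | l == k].
  by case/or3P => /eqP; [exact: Or31 | exact: Or32 | exact: Or33].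
by move: i j k l ij ik jk; do 4 (case=> [[|[|[|//]]]] ?).
Qed.

Lemma ord3_others (k : 'I_3) : exists i j, [/\ i != j, i != k & j != k].
Proof.
by case: k => [[|[|[|//]]]] ?; [exists b2, b3 | exists b1, b3 | exists b1, b2].
Qed.

Lemma sum_distinct {V : nmodType} (i j k : 'I_3) (F : 'I_3 -> V) :
  i != j -> i != k -> j != k -> \sum_l F l = F i + F j + F k.
Proof.
move=> ij ik jk; rewrite (bigD1 i)//= (bigD1 j) 1?eq_sym//=.
rewrite (bigD1 k) ?(eq_sym k)//= ?ik// big1 ?addr0 ?addrA// => l.
by have [->|->|->] := ord3_distinct l ij ik jk; rewrite eqxx ?andbF.
Qed.

Lemma sum_neq_distinct {V : nmodType} (i j k : 'I_3) (F : 'I_3 -> V) :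
  i != j -> i != k -> j != k -> \sum_(l | l != i) F l = F j + F k.
Proof.
move=> ij ik jk; rewrite (bigD1 j) 1?eq_sym//= (bigD1 k) ?(eq_sym k) ?ik//=.
rewrite big1 ?addr0// => l.
by have [->|->|->] := ord3_distinct l ij ik jk; rewrite eqxx ?andbF.
Qed.

(** The potential energy is summed over pairs ordered by index; symmetry of the summand removes the
    order, so that any body can be the far one. *)
Lemma sum_pairs_distinct {V : nmodType} (i j k : 'I_3) (F : 'I_3 -> 'I_3 -> V) :
  (forall i j, F i j = F j i) -> i != j -> i != k -> j != k ->
  \sum_(i < 3) \sum_(j < 3 | (i < j)%N) F i j = F i j + F i k + F j k.
Proof.
move=> FC.
have -> : \sum_(i < 3) \sum_(j < 3 | (i < j)%N) F i j = F b1 b2 + F b1 b3 + F b2 b3.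
  rewrite (@sum_distinct _ b1 b2 b3)//.
  rewrite !(big_mkcond (fun _ : 'I_3 => (_ < _)%N)) /=.
  by rewrite !(@sum_distinct _ b1 b2 b3)//= !add0r !addr0.
have E l := @ord3_distinct b1 b2 b3 l isT isT isT.
case: (E i) (E j) (E k) => -> [] -> [] -> // _ _ _;
  rewrite ?(FC b2 b1) ?(FC b3 b1) ?(FC b3 b2) //.
- by rewrite (addrC (F b1 b2)).
- by rewrite addrAC.
- by rewrite addrC addrA.
- by rewrite -addrA addrC.
- by rewrite addrC (addrC (F b1 b2)) addrA.
Qed.

(** * Jacobi coordinates *)

Lemma row_accel {R : realType} (m : 'I_3 -> R) (x : 'M[R]_3) (i j k : 'I_3) :
  i != j -> i != k -> j != k ->
  row i (accel m x) = (m j / dist x i j ^+ 3) *: (row j x - row i x)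
                      + (m k / dist x i k ^+ 3) *: (row k x - row i x).
Proof.
move=> ij ik jk; apply/rowP => c; rewrite !mxE (sum_neq_distinct _ ij ik jk).
by rewrite !mxE.
Qed.

(** The condition that singles out [component], detached from level and inertia so that it also
    makes sense at a binary collision. Since i and j can be exchanged, the side facing k is shorter
    than both others. *)
Definition shortest {R : realType} k (x : 'M[R]_3) : Prop :=
  forall i j, i != k -> j != k -> i != j -> dist x i j < dist x i k.

Lemma distC {R : realType} (x : 'M[R]_3) i j : dist x i j = dist x j i.
Proof. exact: enormB. Qed.

Lemma shortest_intro {R : realType} (x : 'M[R]_3) (i j k : 'I_3) :
  i != j -> i != k -> j != k -> dist x i j < dist x i k -> dist x i j < dist x j k ->
  shortest k x.
Proof.
move=> ij ik jk dik djk a b ak bk; move: ak bk.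
have [->|->|->] := ord3_distinct a ij ik jk; have [->|->|->] := ord3_distinct b ij ik jk;
  rewrite ?eqxx// => _ _ _.
by rewrite distC.
Qed.

(** * Centered triangles, with an arbitrary body k singled out *)

Section Triangle.
Context {R : realType} {m : 'I_3 -> R} (m_gt0 : forall i, 0 < m i).
Context {i j k : 'I_3} (ij : i != j) (ik : i != k) (jk : j != k).
Implicit Types (x v : 'M[R]_3).

Local Notation mu' := (m i + m j).
Local Notation M := (m i + m j + m k).
Local Notation al := (m i * m j / (m i + m j)).
Local Notation be := (m k * (m i + m j + m k) / (m i + m j)).
Local Notation mm := (m i * m j + m i * m k + m j * m k).
Local Notation centered x := (\sum_i m i *: row i x = 0).
Local Notation xi x := (row j x - row i x).

Let mu_gt0 : 0 < mu'. Proof. exact: addr_gt0. Qed.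
Let mu_neq0 : mu' != 0. Proof. by rewrite gt_eqF. Qed.
Let M_gt0 : 0 < M. Proof. by rewrite addr_gt0. Qed.

(** With the center of mass at the origin, the second Jacobi vector is M / mu' times the position of
    k. The latter is used as coordinate instead, and the coefficient [be], which is alpha_2 (M /
    mu')^2 for the labeling at hand, absorbs the factor. *)
Lemma centered_rowi x : centered x ->
  row i x = - ((m k / mu') *: row k x) - (m j / mu') *: xi x.
Proof.
rewrite (sum_distinct _ ij ik jk) => /rowP cx; apply/rowP => c.
move: (cx c); rewrite !mxE => h.
have -> : m k / mu' * x k c = - (m i * x i c + m j * x j c) / mu'.
  by rewrite mulrAC; congr (_ / _); lra.
by field.
Qed.

Lemma centered_rowj x : centered x ->
  row j x = - ((m k / mu') *: row k x) + (m i / mu') *: xi x.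
Proof.
move=> cx; rewrite -[LHS](subrK (row i x)) {2}(centered_rowi cx).
by apply/rowP => c; rewrite !mxE; field.
Qed.

Lemma centered_diffi x : centered x ->
  row k x - row i x = (M / mu') *: row k x + (m j / mu') *: xi x.
Proof.
move=> cx; rewrite {1}(centered_rowi cx).
by apply/rowP => c; rewrite !mxE; field.
Qed.

Lemma centered_diffj x : centered x ->
  row k x - row j x = (M / mu') *: row k x - (m i / mu') *: xi x.
Proof.
move=> cx; rewrite {1}(centered_rowj cx).
by apply/rowP => c; rewrite !mxE; field.
Qed.

Lemma inertiaE x : centered x ->
  inertia m x = al * enorm (xi x) ^+ 2 + be * enorm (row k x) ^+ 2.
Proof.
move=> cx; rewrite /inertia (sum_distinct _ ij ik jk).
have := centered_rowj cx; have := centered_rowi cx; move: (xi x) => X -> ->.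
by rewrite !sqr_enorm !dotv_lin (dotvC (row k x) X); field.
Qed.

Lemma angmomE x v : centered x -> centered v ->
  angmom m (x, v) = al *: crossv (xi x) (xi v) + be *: crossv (row k x) (row k v).
Proof.
move=> cx cv; rewrite /angmom /= (sum_distinct _ ij ik jk).
have := centered_rowj cx; have := centered_rowi cx; move: (xi x) => X -> ->.
have := centered_rowj cv; have := centered_rowi cv; move: (xi v) => V -> ->.
rewrite !crossv_lin; move: (crossv X V) (crossv X (row k v)) (crossv (row k x) V) (crossv (row k x) (row k v)).
by move=> A B C D; apply/rowP => c; rewrite !mxE; field.
Qed.

(** [inertia] is a quadratic form on triples of vectors, so on velocities it is twice the kinetic
    energy, and [inertiaE] splits that energy between the pair and k. *)
Lemma energyE x v : energy m (x, v) = 2^-1 * inertia m v -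
  (m i * m j / dist x i j + m i * m k / dist x i k + m j * m k / dist x j k).
Proof.
rewrite /energy /= (@sum_pairs_distinct _ i j k)// => a b.
by rewrite distC (mulrC (m a)).
Qed.

Lemma shortest_lt x : shortest k x -> dist x i j < dist x i k /\ dist x i j < dist x j k.
Proof.
move=> h; split; first exact: h.
by rewrite distC; apply: h => //; rewrite eq_sym.
Qed.

(** The distance from k to i or j is at least |row k x| minus the side of the pair, and this side is
    at most that same distance; hence the factor 1/2. *)
Lemma shortest_far x : centered x -> shortest k x ->
  enorm (row k x) / 2 <= dist x i k /\ enorm (row k x) / 2 <= dist x j k.
Proof.
move=> cx /shortest_lt[dik djk].
have M1 : enorm (row k x) <= enorm ((M / mu') *: row k x).
  rewrite enormZ ler_peMl ?enorm_ge0// ger0_norm; last by rewrite divr_ge0// ltW.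
  by rewrite ler_pdivlMr// mul1r lerDl ltW.
have bnd a : 0 < a -> a <= mu' -> enorm ((a / mu') *: xi x) <= dist x i j.
  move=> a0 a1; rewrite enormZ ler_piMl ?enorm_ge0// ger0_norm; last by rewrite divr_ge0// ltW.
  by rewrite ler_pdivrMr// mul1r.
have bi := bnd _ (m_gt0 i); have bj := bnd _ (m_gt0 j).
have {}bi : enorm ((m i / mu') *: xi x) <= dist x i j by apply: bi; rewrite lerDl ltW.
have {}bj : enorm ((m j / mu') *: xi x) <= dist x i j by apply: bj; rewrite lerDr ltW.
split.
  have := lerB_enormD ((M / mu') *: row k x) ((m j / mu') *: xi x).
  by rewrite -centered_diffi// -/(dist x i k); lra.
have := lerB_enormD ((M / mu') *: row k x) (- ((m i / mu') *: xi x)).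
by rewrite enormN -centered_diffj// -/(dist x j k); lra.
Qed.

End Triangle.

Lemma enorm_accel_le {R : realType} (m : 'I_3 -> R) (m_gt0 : forall i, 0 < m i)
    (x : 'M[R]_3) (i j k : 'I_3) : i != j -> i != k -> j != k -> collision_free x ->
  enorm (row i (accel m x)) <= m j / dist x i j ^+ 2 + m k / dist x i k ^+ 2.
Proof.
move=> ij ik jk cf; rewrite (row_accel _ _ ij ik jk).
have bnd l : i != l ->
    enorm ((m l / dist x i l ^+ 3) *: (row l x - row i x)) <= m l / dist x i l ^+ 2.
  move=> il; have d0 : 0 < dist x i l by rewrite enorm_gt0 subr_eq0 eq_sym cf.
  rewrite enormZ -/(dist x i l) ger0_norm; last by rewrite divr_ge0 ?exprn_ge0// ltW.
  by rewrite le_eqVlt; apply/orP; left; apply/eqP; field; rewrite gt_eqF.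
by apply: le_trans (ler_enormD _ _) _; rewrite lerD// bnd.
Qed.

(** * Bounds on a level of negative energy *)

Section TriangleEstimates.
Context {R : realType} {m : 'I_3 -> R} (m_gt0 : forall i, 0 < m i).
Context {i j k : 'I_3} (ij : i != j) (ik : i != k) (jk : j != k).
Context {H : R} (H_lt0 : H < 0).
Context {x v : 'M[R]_3}.

Local Notation mu' := (m i + m j).
Local Notation al := (m i * m j / (m i + m j)).
Local Notation be := (m k * (m i + m j + m k) / (m i + m j)).
Local Notation mm := (m i * m j + m i * m k + m j * m k).
Local Notation xi x := (row j x - row i x).

Hypothesis cf : collision_free x.
Hypothesis cx : \sum_i m i *: row i x = 0.
Hypothesis cv : \sum_i m i *: row i v = 0.
Hypothesis eH : energy m (x, v) = H.
Hypothesis sx : shortest k x.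

Let d_gt0 a b : a != b -> 0 < dist x a b.
Proof. by move=> ab; rewrite enorm_gt0 subr_eq0 eq_sym cf. Qed.

Let mu_gt0 : 0 < mu'. Proof. exact: addr_gt0. Qed.
Let al_gt0 : 0 < al. Proof. by rewrite divr_gt0 ?mulr_gt0. Qed.
Let be_gt0 : 0 < be. Proof. by rewrite divr_gt0 ?mulr_gt0 ?addr_gt0. Qed.

Lemma potential_le :
  m i * m j / dist x i j + m i * m k / dist x i k + m j * m k / dist x j k
    <= mm / dist x i j.
Proof.
have [dik djk] := shortest_lt ij ik jk sx.
rewrite 2!mulrDl; apply: lerD; first apply: lerD => //.
  by rewrite ler_pM2l ?mulr_gt0// lef_pV2 ?posrE ?d_gt0// ltW.
by rewrite ler_pM2l ?mulr_gt0// lef_pV2 ?posrE ?d_gt0// ltW.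
Qed.

Lemma inertia_ge0 (y : 'M[R]_3) : 0 <= inertia m y.
Proof. by apply: sumr_ge0 => l _; rewrite mulr_ge0 ?exprn_ge0 ?enorm_ge0// ltW. Qed.

(** The kinetic energy being nonnegative, the sum of the m m / dist is at least - H, while it is at
    most [mm / dist x i j]. *)
Lemma shortest_le : dist x i j <= mm / - H.
Proof.
rewrite ler_pdivlMr ?oppr_gt0// mulrC -ler_pdivlMr ?d_gt0//.
apply: le_trans potential_le; move: eH; rewrite (energyE ij ik jk).
have := inertia_ge0 v; lra.
Qed.

Lemma enorm_accel_far_le (p0 : R) : 0 < p0 -> p0 <= enorm (row k x) ->
  enorm (row k (accel m x)) <= 4 * mu' / p0 ^+ 2.
Proof.
move=> p0_gt0 p0y; have [dik djk] := shortest_far m_gt0 ij ik jk cx sx.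
have ki : k != i by rewrite eq_sym.
have kj : k != j by rewrite eq_sym.
apply: le_trans (enorm_accel_le m_gt0 ki kj ij cf) _.
have bnd l : k != l -> enorm (row k x) / 2 <= dist x l k ->
    m l / dist x k l ^+ 2 <= 4 * m l / p0 ^+ 2.
  move=> kl dl; rewrite (mulrC 4) -mulrA ler_pM2l// -invf_div lef_pV2; first last.
  - by rewrite posrE divr_gt0 ?exprn_gt0.
  - by rewrite posrE exprn_gt0// d_gt0.
  rewrite (_ : p0 ^+ 2 / 4 = (p0 / 2) ^+ 2); last by field.
  by rewrite lerXn2r ?nnegrE ?enorm_ge0// ?(distC x k l); lra.
by rewrite mulrDr mulrDl lerD// bnd.
Qed.

Lemma enorm_accel_pair_le (p0 d0 : R) : 0 < p0 -> p0 <= enorm (row k x) ->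
  0 < d0 -> d0 <= dist x i j ->
  enorm (row i (accel m x)) <= m j / d0 ^+ 2 + 4 * m k / p0 ^+ 2.
Proof.
move=> p0_gt0 p0y d0_gt0 d0d; have [dik djk] := shortest_far m_gt0 ij ik jk cx sx.
apply: le_trans (enorm_accel_le m_gt0 ij ik jk cf) _; apply: lerD.
  rewrite ler_pM2l// lef_pV2 ?posrE ?exprn_gt0 ?d_gt0//.
  by rewrite ler_sqr// nnegrE ?enorm_ge0// ltW.
rewrite (mulrC 4) -mulrA ler_pM2l// -invf_div lef_pV2; first last.
- by rewrite posrE divr_gt0 ?exprn_gt0.
- by rewrite posrE exprn_gt0// d_gt0.
rewrite (_ : p0 ^+ 2 / 4 = (p0 / 2) ^+ 2); last by field.
by rewrite lerXn2r ?nnegrE ?enorm_ge0//; lra.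
Qed.

(** As H < 0, the kinetic energy is less than the potential term, which is O(1/r). The product of r
    and the relative speed is thus O(sqrt r): this bounds the angular momentum of the pair, and
    forces (r^2)' to 0 at a collision. *)
Lemma pair_velocity_le :
  (dist x i j * enorm (xi v)) ^+ 2 <= 2 * mm / al * dist x i j.
Proof.
have d0 := d_gt0 ij.
have : al * enorm (xi v) ^+ 2 <= 2 * (mm / dist x i j).
  have := eH; rewrite (energyE ij ik jk) (inertiaE m_gt0 ij ik jk cv).
  have := potential_le; have : 0 <= be * enorm (row k v) ^+ 2.
    by rewrite mulr_ge0 ?sqr_ge0// ltW.
  set A := al * _; set B := be * _; set C := mm / _; set D := (_ + _ + _).
  have := H_lt0; lra.
rewrite -ler_pdivlMl// => h; rewrite exprMn.
apply: le_trans (ler_wpM2l (sqr_ge0 _) h) _.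
rewrite le_eqVlt; apply/orP; left; apply/eqP.
by field; rewrite !gt_eqF.
Qed.

Lemma dotv_pair_velocity_le :
  dotv (xi x) (xi v) ^+ 2 <= 2 * mm / al * dist x i j.
Proof.
apply: le_trans pair_velocity_le.
rewrite -[leLHS]real_normK ?num_real// lerXn2r ?nnegrE ?mulr_ge0 ?enorm_ge0//.
exact: cauchy_schwarz.
Qed.

Lemma lagrange_jacobi_ge (p0 : R) : 0 < p0 -> p0 <= enorm (row k x) ->
  (2 * H - be * enorm (row k v) ^+ 2) / al - 4 * m k / p0
    <= dotv (xi v) (xi v) + dotv (xi x) (row j (accel m x) - row i (accel m x)).
Proof.
move=> p0_gt0 p0y; have [dik djk] := shortest_far m_gt0 ij ik jk cx sx.
have [rik rjk] := shortest_lt ij ik jk sx.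
have d0 := d_gt0 ij; have dik0 := d_gt0 ik; have djk0 := d_gt0 jk.
have kin : 2 * mu' / dist x i j + (2 * H - be * enorm (row k v) ^+ 2) / al
    <= dotv (xi v) (xi v).
  rewrite -sqr_enorm.
  have := eH; rewrite (energyE ij ik jk) (inertiaE m_gt0 ij ik jk cv).
  have h1 : 0 < m i * m k / dist x i k by rewrite divr_gt0 ?mulr_gt0.
  have h2 : 0 < m j * m k / dist x j k by rewrite divr_gt0 ?mulr_gt0.
  move=> h; rewrite -(ler_pM2l al_gt0) [leLHS]mulrDr (mulrC al (_ / al)) mulfVK ?gt_eqF//.
  rewrite (_ : al * (2 * mu' / _) = 2 * (m i * m j / dist x i j)); first lra.
  by field; rewrite !gt_eqF.
have ji : j != i by rewrite eq_sym.
rewrite (row_accel _ _ ij ik jk) (row_accel _ _ ji jk ik) (distC x j i).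
rewrite -[row i x - row j x]opprB.
have -> : dotv (xi x) ((m i / dist x i j ^+ 3) *: - xi x
      + (m k / dist x j k ^+ 3) *: (row k x - row j x)
    - ((m j / dist x i j ^+ 3) *: xi x
      + (m k / dist x i k ^+ 3) *: (row k x - row i x)))
    = - (mu' / dist x i j)
      + m k / dist x j k ^+ 3 * dotv (xi x) (row k x - row j x)
      - m k / dist x i k ^+ 3 * dotv (xi x) (row k x - row i x).
  move: (row k x - row j x) (row k x - row i x) => A B.
  move: d0 dik0 djk0 (sqr_enorm (xi x)); rewrite -/(dist x i j).
  move: (dist x i j) (dist x i k) (dist x j k) (xi x) => d e f X d0 e0 f0 dX.
  by rewrite !(dotvDr, dotvNr, dotvZr) -dX; field; rewrite !gt_eqF.
have bnd l : 0 < dist x l k -> dist x i j < dist x l k ->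
    enorm (row k x) / 2 <= dist x l k ->
    `|m k / dist x l k ^+ 3 * dotv (xi x) (row k x - row l x)| <= 2 * m k / p0.
  move=> dl0 rl dl; rewrite normrM ger0_norm; last by rewrite divr_ge0 ?exprn_ge0// ltW.
  apply: (@le_trans _ _ (m k / dist x l k ^+ 3 * (dist x l k * dist x l k))).
    rewrite ler_pM2l ?divr_gt0 ?exprn_gt0//.
    apply: le_trans (cauchy_schwarz _ _) _.
    by rewrite ler_pM ?enorm_ge0// ltW.
  rewrite (_ : _ * _ = m k / dist x l k); last by field; rewrite gt_eqF.
  rewrite (mulrC 2) -mulrA ler_pM2l// -invf_div lef_pV2 ?posrE ?divr_gt0//; lra.
have := bnd i dik0 rik dik; have := bnd j djk0 rjk djk.
rewrite !ler_norml => /andP[+ _] /andP[_ +].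
have : 0 < mu' / dist x i j by rewrite divr_gt0.
move: kin.
lra.
Qed.

End TriangleEstimates.

(** * Motion of a far body *)

Section VectorCalculus.
Context {R : realType}.

Lemma cvg_mxP {T : Type} (F : set_system T) {FF : Filter F} {n p : nat}
    (f : T -> 'M[R]_(n, p)) (x : 'M[R]_(n, p)) :
  f s @[s --> F] --> x <-> forall a c, f s a c @[s --> F] --> x a c.
Proof.
split=> [fx a c|fx].
  exact: (cvg_comp _ _ fx (@coord_continuous R n p a c x)).
apply/cvgrPdist_le => /= e e0; near=> s.
rewrite /Num.Def.normr/= mx_normrE (bigmax_le _ (ltW e0))//= => ac _.
rewrite !mxE/=; move: ac; near: s; apply: filter_forall => -[a c] /=.
exact: ((cvgrPdist_le _ _).1 (fx a c)).
Unshelve. all: by end_near. Qed.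

Lemma cvg_coord {T : Type} (F : set_system T) {FF : Filter F} {n p : nat}
    (f : T -> 'M[R]_(n, p)) (x : 'M[R]_(n, p)) a c :
  f s @[s --> F] --> x -> f s a c @[s --> F] --> x a c.
Proof. by move=> /cvg_mxP. Qed.

Lemma is_derive_mxP {n p : nat} (f : R -> 'M[R]_(n, p)) (f' : 'M[R]_(n, p)) (t : R) :
  is_derive t 1 f f' <-> forall a c, is_derive t 1 (fun s => f s a c) (f' a c).
Proof.
split=> [[df <-] a c|H].
  apply: DeriveDef; first exact: (derivable_mxP _ _ _).1 df a c.
  by rewrite derive_mx// mxE.
have df : derivable f t 1 by apply/derivable_mxP => a c; have [] := H a c.
apply: DeriveDef => //; apply/matrixP => a c.
by rewrite derive_mx// mxE; have [_ ->] := H a c.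
Qed.

Lemma is_derive_row {n p : nat} (f : R -> 'M[R]_(n, p)) f' (t : R) a :
  is_derive t 1 f f' -> is_derive t 1 (fun s => row a (f s)) (row a f').
Proof.
move/is_derive_mxP => H; apply/is_derive_mxP => b c; rewrite mxE.
by under eq_fun do rewrite mxE; exact: H.
Qed.

Lemma cvg_row {T : Type} (F : set_system T) {FF : Filter F} {n p : nat}
    (f : T -> 'M[R]_(n, p)) (x : 'M[R]_(n, p)) a :
  f s @[s --> F] --> x -> row a (f s) @[s --> F] --> row a x.
Proof.
move/cvg_mxP => H; apply/cvg_mxP => b c; rewrite mxE.
by under eq_fun do rewrite mxE; exact: H.
Qed.

Lemma cvg_dotv {T : Type} (F : set_system T) {FF : Filter F}
    (f g : T -> 'rV[R]_3) (x y : 'rV[R]_3) :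
  f s @[s --> F] --> x -> g s @[s --> F] --> y ->
  dotv (f s) (g s) @[s --> F] --> dotv x y.
Proof.
move=> /cvg_mxP fx /cvg_mxP gy.
rewrite dotvE; under eq_fun do rewrite dotvE.
by apply: cvgD; [apply: cvgD|]; apply: cvgM.
Qed.

Lemma cvg_enorm {T : Type} (F : set_system T) {FF : Filter F}
    (f : T -> 'rV[R]_3) (x : 'rV[R]_3) :
  f s @[s --> F] --> x -> enorm (f s) @[s --> F] --> enorm x.
Proof.
by move=> fx; apply: cvg_comp (cvg_dotv fx fx) _; exact: sqrt_continuous.
Qed.

Lemma is_derive_dotv (f g : R -> 'rV[R]_3) f' g' (t : R) :
  is_derive t 1 f f' -> is_derive t 1 g g' ->
  is_derive t 1 (fun s => dotv (f s) (g s)) (dotv f' (g t) + dotv (f t) g').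
Proof.
move=> /is_derive_mxP df /is_derive_mxP dg.
have dc c : is_derive t 1 (fun s => f s 0 c * g s 0 c)
    (f t 0 c *: g' 0 c + g t 0 c *: f' 0 c) by exact: is_deriveM.
under eq_fun do rewrite dotvE.
have := is_deriveD (is_deriveD (dc 0) (dc 1)) (dc (1 + 1)).
move/is_derive_eq; apply.
by rewrite !dotvE /GRing.scale/=; ring.
Qed.

Lemma is_derive_enorm (f : R -> 'rV[R]_3) f' (t : R) :
  is_derive t 1 f f' -> f t != 0 ->
  is_derive t 1 (fun s => enorm (f s)) (dotv (f t) f' / enorm (f t)).
Proof.
move=> df ft0; have ft : 0 < enorm (f t) by rewrite enorm_gt0.
have d1 : is_derive (dotv (f t) (f t)) 1 Num.sqrt (2 * Num.sqrt (dotv (f t) (f t)))^-1.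
  by apply: is_derive1_sqrt; rewrite -sqr_enorm exprn_gt0.
have := @is_derive1_comp _ Num.sqrt _ _ _ _ d1 (is_derive_dotv df df).
move/is_derive_eq; apply; rewrite -/(enorm _) (dotvC f').
by field; rewrite gt_eqF.
Qed.

End VectorCalculus.

Definition newton {R : realType} (m : 'I_3 -> R) (q v : R -> 'M[R]_3) (t : R) : Prop :=
  is_derive t (1 : R) q (v t) /\ is_derive t (1 : R) v (accel m (q t)).

(* |x|^3 times the second derivative of |x|, for x the position of body k. *)
Definition radial_force {R : realType} (m : 'I_3 -> R) k (x w : 'M[R]_3) : R :=
  enorm (crossv (row k x) (row k w)) ^+ 2
  + enorm (row k x) ^+ 2 * dotv (row k x) (row k (accel m x)).

(** On the energy level, [shortest] bounds the side of the pair, and together with p0 it bounds the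
    force on k; negativity of [radial_force] is p'' < 0. *)
Definition far_state {R : realType} (m : 'I_3 -> R) k (H p0 : R) (x w : 'M[R]_3) : Prop :=
  [/\ collision_free x, \sum_i m i *: row i x = 0, \sum_i m i *: row i w = 0,
      energy m (x, w) = H
    & [/\ shortest k x, p0 <= enorm (row k x) & radial_force m k x w < 0]].

(* The part of [three_body_orbit] that survives time reversal, for a motion in
   which [k] remains the far body. *)
Definition far_motion_at {R : realType} (m : 'I_3 -> R) i j k (H p0 : R)
    (q v : R -> 'M[R]_3) (t : R) : Prop :=
  [/\ {for t, continuous q},
      \forall s \near t^', newton m q v s /\ far_state m k H p0 (q s) (v s)
    & (newton m q v t /\ far_state m k H p0 (q t) (v t)) \/
      (row i (q t) = row j (q t) /\
       exists l : 'rV[R]_3, row k (v s) @[s --> t^'] --> l)].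

Section Motion.
Context {R : realType} {m : 'I_3 -> R} (m_gt0 : forall i, 0 < m i).
Context {i j k : 'I_3} (ij : i != j) (ik : i != k) (jk : j != k).
Context {H : R} (H_lt0 : H < 0) {p0 : R} (p0_gt0 : 0 < p0).

Local Notation al := (m i * m j / (m i + m j)).
Local Notation mm := (m i * m j + m i * m k + m j * m k).
Local Notation xi x := (row j x - row i x).
Local Notation newton := (newton m).
Local Notation far_state := (far_state m k H p0).
Local Notation radial_force := (radial_force m k).

Section At.
Context {q v : R -> 'M[R]_3} {t : R} (qvt : far_motion_at m i j k H p0 q v t).

Let q_cont : q s @[s --> t] --> q t. Proof. by have [] := qvt. Qed.

Let q_cont' : q s @[s --> t^'] --> q t.
Proof. by apply: cvg_within_filter q_cont. Qed.

Let near_qv : \forall s \near t^', newton q v s /\ far_state (q s) (v s).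
Proof. by have [] := qvt. Qed.

Let v_cont' : newton q v t -> v s @[s --> t^'] --> v t.
Proof.
case=> _ [dv _]; apply: cvg_within_filter; apply: differentiable_continuous.
exact/derivable1_diffP.
Qed.

Lemma far_velocity_cvg : exists l : 'rV[R]_3, row k (v s) @[s --> t^'] --> l.
Proof.
have [_ _ [[nt _]|[]//]] := qvt.
by exists (row k (v t)); apply: cvg_row; exact: v_cont'.
Qed.

Lemma far_position_ge : p0 <= enorm (row k (q t)).
Proof.
have h : enorm (row k (q s)) @[s --> t^'] --> enorm (row k (q t)).
  by apply: cvg_enorm; exact: cvg_row.
apply: (cvgr_to_ge h); near=> s.
by have [_ [_ _ _ _ []]] : newton q v s /\ far_state (q s) (v s) by near: s.
Unshelve. all: by end_near. Qed.

Let enorm_qk_gt0 : 0 < enorm (row k (q t)).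
Proof. exact: lt_le_trans far_position_ge. Qed.

Lemma position_continuous a c : {for t, continuous (fun s => q s a c)}.
Proof. exact: cvg_coord. Qed.

Lemma position_piecewise a c :
  piecewise_derive (fun s => q s a c) (fun s => v s a c) t.
Proof.
split; first by apply/cvg_ex; exists (q t a c); exact: cvg_coord.
by apply: filterS near_qv => s [[/is_derive_mxP]].
Qed.

Lemma far_velocity_piecewise c :
  piecewise_derive (fun s => v s k c) (fun s => accel m (q s) k c) t.
Proof.
split.
  have [l /cvg_mxP /(_ 0 c) h] := far_velocity_cvg.
  by apply/cvg_ex; exists (l 0 c); move: h; under eq_fun do rewrite mxE.
by apply: filterS near_qv => s [[_ /is_derive_mxP]].
Qed.

Lemma radius_continuous : {for t, continuous (fun s => enorm (row k (q s)))}.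
Proof. by apply: cvg_enorm; exact: cvg_row. Qed.

Lemma radius_piecewise : piecewise_derive (fun s => enorm (row k (q s)))
  (fun s => dotv (row k (q s)) (row k (v s)) / enorm (row k (q s))) t.
Proof.
split.
  by apply/cvg_ex; exists (enorm (row k (q t))); apply: cvg_enorm; exact: cvg_row.
apply: filterS near_qv => s [[dq _] [_ _ _ _ [_ pk _]]].
apply: is_derive_enorm; first exact: is_derive_row.
by rewrite -enorm_gt0 (lt_le_trans p0_gt0).
Qed.

Lemma radial_velocity_piecewise : piecewise_derive
  (fun s => dotv (row k (q s)) (row k (v s)) / enorm (row k (q s)))
  (fun s => radial_force (q s) (v s) / enorm (row k (q s)) ^+ 3) t.
Proof.
split.
  have [l h] := far_velocity_cvg.
  apply/cvg_ex; exists (dotv (row k (q t)) l / enorm (row k (q t))).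
  apply: cvgM; first by apply: cvg_dotv h; exact: cvg_row.
  apply: cvgV; first by rewrite gt_eqF.
  by apply: cvg_enorm; exact: cvg_row.
apply: filterS near_qv => s [[dq dv] [_ _ _ _ [_ pk _]]].
have pk0 : 0 < enorm (row k (q s)) by exact: lt_le_trans pk.
have d1 := is_derive_dotv (is_derive_row k dq) (is_derive_row k dv).
have qk0 : row k (q s) != 0 by rewrite -enorm_gt0.
have pk_neq0 : enorm (row k (q s)) != 0 by rewrite gt_eqF.
have d2 := is_derive_enorm (is_derive_row k dq) qk0.
have := is_deriveM d1 (@is_deriveV _ (fun s => enorm (row k (q s))) _ _ _ pk_neq0 d2); move/is_derive_eq; apply.
rewrite /radial_force dotv_crossv -!sqr_enorm /GRing.scale/=.
by field.
Qed.

Lemma radial_acceleration_lt0 : \forall s \near t^',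
  radial_force (q s) (v s) / enorm (row k (q s)) ^+ 3 < 0.
Proof.
apply: filterS near_qv => s [_ [_ _ _ _ [_ pk rf]]].
by rewrite pmulr_llt0// invr_gt0 exprn_gt0// (lt_le_trans p0_gt0).
Qed.

Lemma pair_sqr_continuous : {for t, continuous (fun s => dotv (xi (q s)) (xi (q s)))}.
Proof. by apply: cvg_dotv; apply: cvgB; exact: cvg_row. Qed.

Lemma pair_sqr_piecewise : piecewise_derive (fun s => dotv (xi (q s)) (xi (q s)))
  (fun s => 2 * dotv (xi (q s)) (xi (v s))) t.
Proof.
split.
  apply/cvg_ex; exists (dotv (xi (q t)) (xi (q t))).
  by apply: cvg_dotv; apply: cvgB; exact: cvg_row.
apply: filterS near_qv => s [[dq _] _].
have d1 := is_deriveB (is_derive_row j dq) (is_derive_row i dq).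
have := is_derive_dotv d1 d1; move/is_derive_eq; apply.
by rewrite (dotvC (xi (v s))); ring.
Qed.

(** At a collision the relative velocity blows up, but its product with the relative position is
    O(sqrt r) and is squeezed to 0. *)
Lemma pair_velocity_piecewise : piecewise_derive
  (fun s => 2 * dotv (xi (q s)) (xi (v s)))
  (fun s => 2 * (dotv (xi (v s)) (xi (v s)) + dotv (xi (q s)) (xi (accel m (q s))))) t.
Proof.
split; last first.
  apply: filterS near_qv => s [[dq dv] _].
  have d1 := is_deriveB (is_derive_row j dq) (is_derive_row i dq).
  have d2 := is_deriveB (is_derive_row j dv) (is_derive_row i dv).
  exact: (is_deriveZ 2 (is_derive_dotv d1 d2)).
suff [l h] : exists l, dotv (xi (q s)) (xi (v s)) @[s --> t^'] --> (l : R).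
  by apply/cvg_ex; exists (2 * l); exact: cvgMr.
have [_ _ [[nt _]|[qij _]]] := qvt.
  exists (dotv (xi (q t)) (xi (v t))).
  have vt := v_cont' nt.
  by apply: cvg_dotv; apply: cvgB; exact: cvg_row.
exists 0; apply: norm_cvg0; apply: (@squeeze_cvgr _ _ _ _ (cst 0)
  (fun s => Num.sqrt (2 * mm / al * enorm (xi (q s))))).
- near=> s; rewrite normr_ge0/= -sqrtr_sqr; apply: ler_wsqrtr.
  have [_ [cf cx cv eH [sx _ _]]] : newton q v s /\ far_state (q s) (v s) by near: s.
  exact: (dotv_pair_velocity_le m_gt0 ij ik jk H_lt0 cf cv eH sx).
- exact: cvg_cst.
- have -> : (0 : R) = Num.sqrt (2 * mm / al * enorm (xi (q t))).
    rewrite qij subrr (_ : enorm 0 = 0) ?mulr0 ?sqrtr0//.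
    by apply/eqP; rewrite enorm_eq0.
  apply: cvg_comp; last exact: sqrt_continuous.
  by apply: cvgMr; apply: cvg_enorm; apply: cvgB; exact: cvg_row.
Unshelve. all: by end_near. Qed.

End At.
End Motion.

(** * Endpoints of a far motion *)

Section FarMotion.
Context {R : realType} {m : 'I_3 -> R} (m_gt0 : forall i, 0 < m i).
Context {i j k : 'I_3} (ij : i != j) (ik : i != k) (jk : j != k).
Context {H : R} (H_lt0 : H < 0) {p0 : R} (p0_gt0 : 0 < p0).

Local Notation mu' := (m i + m j).
Local Notation al := (m i * m j / (m i + m j)).
Local Notation be := (m k * (m i + m j + m k) / (m i + m j)).
Local Notation mm := (m i * m j + m i * m k + m j * m k).
Local Notation xi x := (row j x - row i x).
Local Notation motion_at := (far_motion_at m i j k H p0).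
Implicit Types r s t : R.

Lemma far_motion_not_entire (q v : R -> 'M[R]_3) : ~ (forall t, motion_at q v t).
Proof.
move=> qv; apply: (@strictly_concave_not_positive R
  (fun s => enorm (row k (q s)))
  (fun s => dotv (row k (q s)) (row k (v s)) / enorm (row k (q s)))
  (fun s => radial_force m k (q s) (v s) / enorm (row k (q s)) ^+ 3)) => t.
- exact: lt_le_trans (far_position_ge (qv t)).
- exact: radius_continuous (qv t).
- exact: radius_piecewise (qv t).
- split; first exact: radial_velocity_piecewise (qv t).
  exact: radial_acceleration_lt0 (qv t).
Qed.

(** [far_motion_at] gives the center of mass only at regular states; at a collision it is recovered
    by continuity of q. *)
Lemma far_position_centered (q v : R -> 'M[R]_3) t :
  motion_at q v t -> \sum_i m i *: row i (q t) = 0.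
Proof.
case=> qt qv _.
have h : \sum_i m i *: row i (q s) @[s --> t^'] --> \sum_i m i *: row i (q t).
  rewrite (sum_distinct _ ij ik jk); under eq_fun do rewrite (sum_distinct _ ij ik jk).
  have qt' : q s @[s --> t^'] --> q t by apply: cvg_within_filter qt.
  by apply: cvgD; [apply: cvgD|]; apply: cvgZr; exact: cvg_row.
have h0 : \sum_i m i *: row i (q s) @[s --> t^'] --> (0 : 'rV[R]_3).
  apply: cvg_trans (@cvg_cst _ (0 : 'rV[R]_3) _ (t^') _).
  by apply: near_eq_cvg; apply: filterS qv => s [_ [_ -> _ _ _]].
exact: (cvg_unique _ h h0).
Qed.

Section LeftLimit.
Context {q v : R -> 'M[R]_3} {e : R} (e_gt0 : 0 < e).
Context (qv : forall t : R, 0 <= t -> t < e -> motion_at q v t).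

Let near_far r : 0 <= r -> r < e ->
  \forall s \near r^', newton m q v s /\ far_state m k H p0 (q s) (v s).
Proof. by move=> r0 re; have [] := qv r0 re. Qed.

Let abs_coord_le (x : 'M[R]_3) a c : `|x a c| <= enorm (row a x).
Proof. by have := coord_le_enorm (row a x) c; rewrite mxE. Qed.

Lemma far_velocity_bounded : exists V : R, forall r c, 0 <= r -> r < e ->
  `|ext (fun s => v s k c) r| <= V.
Proof.
pose C := 4 * mu' / p0 ^+ 2 * (e - 0).
pose V0 c := `|ext (fun s => v s k c) 0| + C.
(* The sum of the nonnegative [V0 c] is one bound for all three coordinates. *)
exists (\sum_c V0 c) => r c r0 re.
have C0 : 0 <= C.
  by rewrite mulr_ge0 ?subr_ge0 ?divr_ge0 ?mulr_ge0 ?exprn_ge0 ?addr_ge0// ltW.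
apply: (@le_trans _ _ (V0 c)); last first.
  rewrite (bigD1 c)//= lerDl; apply: sumr_ge0 => c' _.
  by rewrite addr_ge0.
apply: (@piecewise_lipschitz_bounded _ _ (fun s => accel m (q s) k c)) => // s s0 se.
split; first exact: far_velocity_piecewise (qv s0 se) c.
apply: filterS (near_far s0 se) => x [_ [cf cx cv eH [sx pk _]]].
exact: le_trans (abs_coord_le _ _ _)
  (enorm_accel_far_le m_gt0 ij ik jk cf cx sx p0_gt0 pk).
Qed.

Let near_far_velocity_le (V : R) : (forall r c, 0 <= r -> r < e ->
    `|ext (fun s => v s k c) r| <= V) -> forall r c, 0 < r -> r < e ->
  \forall s \near r^', `|v s k c| <= V.
Proof.
move=> hV r c r0 re.
have pr := far_velocity_piecewise (qv (ltW r0) re) c.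
near=> s; have [s0 se] : 0 < s /\ s < e by near: s; exact: dnbhs_between.
have <- : ext (fun s => v s k c) s = v s k c by near: s; exact: ext_near pr.
by apply: hV => //; exact: ltW.
Unshelve. all: by end_near. Qed.

Lemma far_position_cvg c : cvg (q s k c @[s --> e^'-]).
Proof.
have e0 := e_gt0; have [V hV] := far_velocity_bounded.
(* Starting at e / 2 keeps the punctured neighborhoods inside ]0, e[, where [V] bounds the
   velocity. *)
apply: (@lipschitz_cvg_left _ _ (fun s => v s k c) V (e / 2)); first lra.
move=> r r2 re; have r0 : 0 < r by lra.
have qvr := qv (ltW r0) re; split.
- exact: position_continuous qvr k c.
- exact: position_piecewise qvr k c.
- exact: near_far_velocity_le.
Qed.

Let D0 := mm / - H.

Lemma pair_sqr_bound t : 0 <= t -> t < e ->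
  0 <= dotv (xi (q t)) (xi (q t)) <= D0 ^+ 2.
Proof.
move=> t0 te; rewrite dotv_ge0 -sqr_enorm/=.
have D00 : 0 <= D0.
  by rewrite divr_ge0 ?oppr_ge0 ?addr_ge0 ?mulr_ge0// ltW.
have [_ _ [[_ [cf cx cv eH [sx _ _]]]|[-> _]]] := qv t0 te; last first.
  by rewrite subrr sqr_enorm dotvE !mxE !mul0r !addr0 sqr_ge0.
rewrite lerXn2r ?nnegrE ?enorm_ge0//.
exact: (shortest_le m_gt0 ij ik jk H_lt0 cf eH sx).
Qed.

Lemma pair_sqr_cvg : cvg (dotv (xi (q s)) (xi (q s)) @[s --> e^'-]).
Proof.
have e0 := e_gt0; have [V hV] := far_velocity_bounded.
(* The lower bound of [lagrange_jacobi_ge] with |v_k|^2 replaced by 3 V^2. The semiconvexity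
   constant is taken nonnegative by the maximum with 0, and twice [C0] because the derivative of r^2
   is 2 xi . xi'. *)
pose C0 := (2 * H - be * (V ^+ 2 + V ^+ 2 + V ^+ 2)) / al - 4 * m k / p0.
pose C := Num.max 0 (- (2 * C0)).
apply: (@semiconvex_bounded_cvg_left _ _
  (fun s => 2 * dotv (xi (q s)) (xi (v s)))
  (fun s => 2 * (dotv (xi (v s)) (xi (v s)) + dotv (xi (q s)) (xi (accel m (q s)))))
  C (D0 ^+ 2) (e / 2) e).
- by lra.
- by rewrite le_max lexx.
- by move=> r r2 re; apply: pair_sqr_continuous (qv _ re); lra.
- by move=> r r2 re; apply: pair_sqr_bound => //; lra.
- by move=> r r2 re; apply: pair_sqr_piecewise (qv _ re); lra.
move=> r r2 re; have r0 : 0 < r by lra.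
split; first exact: pair_velocity_piecewise (qv (ltW r0) re).
near=> s.
have [_ [cf cx cv eH [sx pk _]]] : newton m q v s /\ far_state m k H p0 (q s) (v s).
  by near: s; exact: near_far (ltW r0) re.
have vV : forall c, `|v s k c| <= V.
  by near: s; apply: filter_forall => c; exact: near_far_velocity_le.
have := lagrange_jacobi_ge m_gt0 ij ik jk cf cx cv eH sx p0_gt0 pk.
suff : C0 <= (2 * H - be * enorm (row k (v s)) ^+ 2) / al - 4 * m k / p0.
  have CC0 : - (2 * C0) <= C by rewrite le_max lexx orbT.
  move=> C0X XY; apply: (@le_trans _ _ (2 * C0)); first lra.
  by rewrite ler_pM2l//; exact: le_trans C0X XY.
rewrite lerB// ler_pM2r ?invr_gt0 ?divr_gt0 ?mulr_gt0 ?addr_gt0//.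
rewrite lerB// ler_pM2l ?divr_gt0 ?mulr_gt0 ?addr_gt0//.
rewrite sqr_enorm dotvE !mxE -!expr2.
have V2 c : v s k c ^+ 2 <= V ^+ 2.
  rewrite -[leLHS]real_normK ?num_real// lerXn2r ?nnegrE//.
  exact: le_trans (vV c).
by rewrite !lerD.
Unshelve. all: by end_near. Qed.

Lemma far_limit_ge (x : 'M[R]_3) :
  row k (q s) @[s --> e^'-] --> row k x -> p0 <= enorm (row k x).
Proof.
move=> qx; apply: (cvgr_to_ge (cvg_enorm qx)); near=> s.
have s0 : 0 < s by near: s; exact: nbhs_left_gt.
have se : s < e by near: s; exact: nbhs_left_lt.
exact: far_position_ge (qv (ltW s0) se).
Unshelve. all: by end_near. Qed.

Lemma collision_limit : dotv (xi (q s)) (xi (q s)) @[s --> e^'-] --> (0 : R) ->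
  exists x : 'M[R]_3, binary_collision k x /\ q s @[s --> e^'-] --> x.
Proof.
move=> xi0.
pose y c := lim (q s k c @[s --> e^'-]).
have qy c : q s k c @[s --> e^'-] --> y c by exact: far_position_cvg.
have xic c : q s j c - q s i c @[s --> e^'-] --> (0 : R).
  apply: norm_cvg0; apply: (@squeeze_cvgr _ _ _ _ (cst 0)
    (fun s => Num.sqrt (dotv (xi (q s)) (xi (q s))))).
  - near=> s; rewrite normr_ge0/=.
    by have := coord_le_enorm (xi (q s)) c; rewrite !mxE.
  - exact: cvg_cst.
  - rewrite -sqrtr0; apply: cvg_comp xi0 _; exact: sqrt_continuous.
(* The two merged bodies sit where the center of mass puts them once k is at its limit y. *)
pose x : 'M[R]_3 := \matrix_(a, c) (if a == k then y c else - (m k / mu' * y c)).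
have qic c : q s i c @[s --> e^'-] --> - (m k / mu' * y c).
  have h : - (m k / mu' * q s k c) - m j / mu' * (q s j c - q s i c)
      @[s --> e^'-] --> - (m k / mu' * y c) - m j / mu' * 0.
    by apply: cvgB; [apply: cvgN|]; exact: cvgMr.
  rewrite mulr0 subr0 in h; apply: cvg_trans h; apply: near_eq_cvg; near=> s.
  have s0 : 0 < s by near: s; exact: nbhs_left_gt.
  have se : s < e by near: s; exact: nbhs_left_lt.
  have := far_position_centered (qv (ltW s0) se).
  move/(centered_rowi m_gt0 ij ik jk)/rowP/(_ c).
  by rewrite !mxE.
have qjc c : q s j c @[s --> e^'-] --> - (m k / mu' * y c).
  have h : q s j c - q s i c + q s i c @[s --> e^'-] --> 0 - m k / mu' * y c.
    by apply: cvgD; [exact: xic | exact: qic].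
  rewrite sub0r in h; apply: cvg_trans h.
  by apply: near_eq_cvg; near=> s; rewrite /= subrK.
have qx : q s @[s --> e^'-] --> x.
  apply/cvg_mxP => a c; rewrite mxE; have [->|->|->] := ord3_distinct a ij ik jk.
  - by rewrite (negbTE ik).
  - by rewrite (negbTE jk).
  - by rewrite eqxx.
exists x; split=> //; split=> [a b ak bk|a ak].
  by apply/rowP => c; rewrite !mxE (negbTE ak) (negbTE bk).
(* If the pair met k in the limit, centering would give M y = 0, against |y| >= p0. *)
apply/eqP => xak.
have pk : 0 < enorm (row k x).
  by apply: (lt_le_trans p0_gt0); apply: far_limit_ge; exact: cvg_row.
have : row k x = 0.
  apply/rowP => c; have /rowP/(_ c) := xak.
  rewrite !mxE (negbTE ak) eqxx => h.
  have : (m i + m j + m k) * y c = 0.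
    rewrite mulrDl -{1}h; field.
    by rewrite gt_eqF// addr_gt0.
  by move/eqP; rewrite mulf_eq0 gt_eqF ?addr_gt0//= => /eqP.
by move/eqP; rewrite -enorm_eq0 gt_eqF.
Unshelve. all: by end_near. Qed.

(** Near e the pair stays at distance at least sqrt (L / 2), and k at distance at least p0 / 2 from
    both: collisions are excluded, all accelerations are bounded, velocities converge, and then so
    do positions. *)
Lemma regular_limit (L : R) : 0 < L ->
  dotv (xi (q s)) (xi (q s)) @[s --> e^'-] --> L ->
  exists x w : 'M[R]_3, [/\ collision_free x,
    q s @[s --> e^'-] --> x & v s @[s --> e^'-] --> w].
Proof.
move=> L0 xiL; have e0 := e_gt0; have ji : j != i by rewrite eq_sym.
pose d0 := Num.sqrt (L / 2).
have d0_gt0 : 0 < d0 by rewrite sqrtr_gt0; lra.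
have nearL : \forall s \near e^'-, L / 2 <= dotv (xi (q s)) (xi (q s)).
  by apply: (cvgr_ge _ xiL); lra.
have [t1 [t10 t1e dt1]] : exists t1, [/\ 0 < t1, t1 < e &
    forall s, t1 <= s -> s < e -> d0 <= dist (q s) i j].
  move: nearL; rewrite near_withinE => /nbhs_ballP[/= d d_gt0 hd].
  pose t1 := Num.max (e / 2) (e - d / 2).
  have t1e : t1 < e by rewrite gt_max; apply/andP; split; lra.
  exists t1; split=> //; first by rewrite lt_max; apply/orP; left; lra.
  move=> s t1s se; apply: ler_wsqrtr; apply: hd => //.
  rewrite /ball/= ger0_norm; last lra.
  by move: t1s; rewrite ge_max => /andP[_]; lra.
have reg r : t1 <= r -> r < e -> newton m q v r /\ far_state m k H p0 (q r) (v r).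
  move=> t1r re; have [_ _ [//|[rij _]]] := qv (le_trans (ltW t10) t1r) re.
  have := dt1 r t1r re; rewrite /dist rij subrr.
  have -> : enorm (0 : 'rV[R]_3) = 0 by apply/eqP; rewrite enorm_eq0.
  by rewrite leNgt d0_gt0.
pose C := \sum_l 4 * m l / p0 ^+ 2 + \sum_l m l / d0 ^+ 2.
have C1 l : 0 <= 4 * m l / p0 ^+ 2 by rewrite divr_ge0 ?mulr_ge0 ?exprn_ge0// ltW.
have C2 l : 0 <= m l / d0 ^+ 2 by rewrite divr_ge0 ?mulr_ge0 ?exprn_ge0// ltW.
have accC r a c : t1 <= r -> r < e -> `|accel m (q r) a c| <= C.
  move=> t1r re; apply: le_trans (abs_coord_le _ _ _) _.
  have [_ [cf cx cv eH [sx pk _]]] := reg r t1r re.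
  rewrite /C !(sum_distinct _ ij ik jk).
  move: (C1 i) (C1 j) (C1 k) (C2 i) (C2 j) (C2 k).
  have [->|->|->] := ord3_distinct a ij ik jk.
  - have := enorm_accel_pair_le m_gt0 ij ik jk cf cx sx p0_gt0 pk d0_gt0 (dt1 r t1r re).
    by lra.
  - have dji : d0 <= dist (q r) j i by rewrite distC; exact: dt1.
    have := enorm_accel_pair_le m_gt0 ji jk ik cf cx sx p0_gt0 pk d0_gt0 dji.
    by lra.
  - have := enorm_accel_far_le m_gt0 ij ik jk cf cx sx p0_gt0 pk.
    by rewrite mulrDr mulrDl; lra.
(* Each estimate uses the previous one on punctured neighborhoods, whence increasing starting
   points: accelerations are bounded from t1 on, velocities from t2 on, and positions are treated
   from t3 on. *)
pose t2 := (t1 + e) / 2; have [t12 t2e] : t1 < t2 /\ t2 < e by rewrite /t2; lra.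
pose t3 := (t2 + e) / 2; have [t23 t3e] : t2 < t3 /\ t3 < e by rewrite /t3; lra.
have nearreg r : t1 < r -> r < e -> \forall s \near r^', t1 <= s /\ s < e.
  move=> t1r re; apply: filterS (dnbhs_between t1r re) => s [/ltW].
  by [].
have vcont r a c : t1 < r -> r < e -> {for r, continuous (fun s => v s a c)}.
  move=> t1r re; have [[_ /is_derive_mxP dv] _] := reg r (ltW t1r) re.
  exact: is_derive_continuous (dv a c).
have vpw r a c : t1 < r -> r < e ->
    piecewise_derive (fun s => v s a c) (fun s => accel m (q s) a c) r.
  move=> t1r re; split.
    apply/cvg_ex; exists (v r a c).
    by apply: cvg_within_filter; exact: vcont.
  apply: filterS (nearreg r t1r re) => s [t1s se].
  by have [[_ /is_derive_mxP dv] _] := reg s t1s se.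
have vlip a c r : t2 <= r -> r < e -> [/\ {for r, continuous (fun s => v s a c)},
    piecewise_derive (fun s => v s a c) (fun s => accel m (q s) a c) r
    & \forall x \near r^', `|accel m (q x) a c| <= C].
  move=> t2r re; have t1r := lt_le_trans t12 t2r; split.
  - exact: vcont.
  - exact: vpw.
  - by apply: filterS (nearreg r t1r re) => s [t1s se]; exact: accC.
have vcvg a c : cvg (v s a c @[s --> e^'-]) by exact: lipschitz_cvg_left t2e (vlip a c).
have qcvg a c : cvg (q s a c @[s --> e^'-]).
  apply: (@lipschitz_cvg_left _ _ (fun s => v s a c)
    (`|ext (fun s => v s a c) t2| + C * (e - t2)) t3) => // r t3r re.
  have r0 : 0 <= r by lra.
  have t2r : t2 < r by exact: lt_le_trans t23 t3r.
  split.
  - exact: position_continuous (qv r0 re) a c.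
  - exact: position_piecewise (qv r0 re) a c.
  apply: filterS (dnbhs_between t2r re) => s [t2s se].
  rewrite -(ext_continuous (vcont s a c (lt_trans t12 t2s) se)).
  apply: (@piecewise_lipschitz_bounded _ _ (fun s => accel m (q s) a c)) => //.
    by move=> u t2u ue; have [] := vlip a c u t2u ue.
  exact: ltW.
pose x : 'M[R]_3 := \matrix_(a, c) lim (q s a c @[s --> e^'-]).
pose w : 'M[R]_3 := \matrix_(a, c) lim (v s a c @[s --> e^'-]).
have qx : q s @[s --> e^'-] --> x by apply/cvg_mxP => a c; rewrite mxE; exact: qcvg.
have vw : v s @[s --> e^'-] --> w by apply/cvg_mxP => a c; rewrite mxE; exact: vcvg.
exists x, w; split=> // a b ab.
have dlim (d : R) : 0 < d ->
    (forall s, t1 <= s -> s < e -> d <= dist (q s) a b) -> row a x != row b x.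
  move=> d_gt0 hd; rewrite eq_sym -subr_eq0 -enorm_gt0; apply: lt_le_trans d_gt0 _.
  have h : dist (q s) a b @[s --> e^'-] --> dist x a b.
    by apply: cvg_enorm; apply: cvgB; exact: cvg_row.
  apply: (cvgr_to_ge h); near=> s.
  by apply: hd; near: s; [exact: nbhs_left_ge | exact: nbhs_left_lt].
have dfar s : t1 <= s -> s < e -> p0 / 2 <= dist (q s) i k /\ p0 / 2 <= dist (q s) j k.
  move=> t1s se; have [_ [cf cx cv eH [sx pk _]]] := reg s t1s se.
  have := shortest_far m_gt0 ij ik jk cx sx.
  lra.
have p02 : 0 < p0 / 2 by rewrite divr_gt0.
move: ab dlim; have [->|->|->] := ord3_distinct a ij ik jk;
  have [->|->|->] := ord3_distinct b ij ik jk; rewrite ?eqxx// => _ dlim.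
- exact: (dlim d0).
- by apply: (dlim (p0 / 2)) => // s t1s se; have [] := dfar s t1s se.
- by apply: (dlim d0) => // s t1s se; rewrite distC; exact: dt1.
- by apply: (dlim (p0 / 2)) => // s t1s se; have [] := dfar s t1s se.
- by apply: (dlim (p0 / 2)) => // s t1s se; rewrite distC; have [] := dfar s t1s se.
- by apply: (dlim (p0 / 2)) => // s t1s se; rewrite distC; have [] := dfar s t1s se.
Unshelve. all: by end_near. Qed.

Lemma far_motion_continuable : ~ not_continuable q v (e^'-).
Proof.
case=> noreg nocoll; have /cvg_ex[/= L xiL] := pair_sqr_cvg.
have : 0 <= L by apply: (cvgr_to_ge xiL); near=> s; exact: dotv_ge0.
rewrite le_eqVlt => /predU1P[L0|L0]; last exact/noreg/(regular_limit L0 xiL).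
by apply: nocoll; exists k; apply: collision_limit; rewrite L0.
Unshelve. all: by end_near. Qed.

End LeftLimit.
End FarMotion.

(** * Orbits *)

Section TimeReversal.
Context {R : realType}.
Implicit Types (q v : R -> 'M[R]_3) (t : R).

Lemma near_dnbhsN (P : R -> Prop) t :
  (\forall s \near t^', P s) -> \forall s \near (- t)^', P (- s).
Proof.
rewrite !near_withinE => /nbhs_ballP[e/= e0 h]; apply/nbhs_ballP; exists e => //= s.
rewrite /ball/= => ts st; apply: h; last by rewrite eqr_oppLR.
by rewrite /ball/= opprK -normrN opprD.
Qed.

Lemma cvg_dnbhsN {T : topologicalType} (f : R -> T) t (l : T) :
  f s @[s --> t^'] --> l -> f (- s) @[s --> (- t)^'] --> l.
Proof. by move=> h A /h; exact: near_dnbhsN. Qed.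

Lemma is_derive_reversal q (dq : 'M[R]_3) t : is_derive t 1 q dq ->
  is_derive (- t) 1 (fun s => q (- s)) (- dq).
Proof.
move=> /is_derive_mxP h; apply/is_derive_mxP => a c.
have h1 : is_derive (- - t) 1 (fun s => q s a c) (dq a c) by rewrite opprK.
have := @is_derive1_comp _ _ _ _ _ _ h1 (is_deriveNid (- t) 1).
by move/is_derive_eq; apply; rewrite mxE mulrN1.
Qed.

Lemma newton_reversal (m : 'I_3 -> R) q v t : newton m q v t ->
  newton m (fun s => q (- s)) (fun s => - v (- s)) (- t).
Proof.
case=> dq dv; split; first by rewrite opprK; exact: is_derive_reversal.
have := is_deriveN (is_derive_reversal dv).
by rewrite !opprK.
Qed.

Lemma row_opp (x : 'M[R]_3) a : row a (- x) = - row a x.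
Proof. exact: linearN. Qed.

(** The energy and [radial_force] are even in the velocities. The angular momentum is odd, which is
    why [far_state] does not record it. *)
Lemma far_state_reversal (m : 'I_3 -> R) k H p0 (x w : 'M[R]_3) :
  far_state m k H p0 x w -> far_state m k H p0 x (- w).
Proof.
case=> cf cx cw eH [sx px rf]; split=> //.
- under eq_bigr do rewrite row_opp scalerN.
  by rewrite sumrN cw oppr0.
- rewrite -eH /energy /=; congr (_ * _ - _).
  by apply: eq_bigr => a _; rewrite row_opp enormN.
- by split=> //; rewrite /radial_force row_opp crossvNr enormN.
Qed.

Lemma far_motion_at_reversal (m : 'I_3 -> R) i j k H p0 q v t :
  far_motion_at m i j k H p0 q v t ->
  far_motion_at m i j k H p0 (fun s => q (- s)) (fun s => - v (- s)) (- t).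
Proof.
case=> qt near_qv alt; split.
- have h : q (- s) @[s --> - t] --> q t by apply/cvg_compNP; rewrite opprK.
  by move: h; rewrite -{2}[t]opprK.
- have := near_dnbhsN near_qv; apply: filterS => s [/newton_reversal ns fs].
  by rewrite opprK in ns; split=> //; exact: far_state_reversal.
- rewrite !opprK; case: alt => [[/newton_reversal nt ft]|[qij vk]]; [left|right].
    by split=> //; exact: far_state_reversal.
  split=> //; have [l vl] := vk; exists (- l).
  have h : - row k (v (- s)) @[s --> (- t)^'] --> - l.
    by apply: cvgN; exact: cvg_dnbhsN vl.
  by apply: cvg_trans h; apply: near_eq_cvg; near=> s; rewrite row_opp.
Unshelve. all: by end_near. Qed.

Lemma not_continuable_reversal q v (e : R) : not_continuable q v (e^'+) ->
  not_continuable (fun s => q (- s)) (fun s => - v (- s)) ((- e)^'-).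
Proof.
case=> noreg nocoll; split=> [[x [w [cf qx vw]]]|[k [x [bc qx]]]].
- apply: noreg; exists x, (- w); split=> //; apply/cvg_at_rightNP => //.
  have h : - - v (- s) @[s --> (- e)^'-] --> - w by apply: cvgN.
  by apply: cvg_trans h; apply: near_eq_cvg; near=> s; rewrite /= opprK.
- by apply: nocoll; exists k, x; split=> //; apply/cvg_at_rightNP.
Unshelve. all: by end_near. Qed.

End TimeReversal.

(** * The far body along an orbit *)

Section Orbit.
Context {R : realType} {m : 'I_3 -> R} (m_gt0 : forall i, 0 < m i).
Context {H : R} (H_lt0 : H < 0) {J : 'rV[R]_3} {a b : \bar R} {q v : R -> 'M[R]_3}.
Hypothesis orb : three_body_orbit m H J a b q v.
Implicit Types (t s : R) (x : 'M[R]_3).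

(** A finite endpoint on either side gives the contradiction, since the study of the limit at e
    concerns [0, e[ only: a finite b is taken as e, a finite a becomes the right endpoint - a of the
    reversed motion. With neither, the motion is entire. *)
Lemma far_motion_not_orbit i j k (p0 : R) : i != j -> i != k -> j != k -> 0 < p0 ->
  ~ (forall t, (a < t%:E)%E -> (t%:E < b)%E -> far_motion_at m i j k H p0 q v t).
Proof.
move=> ij ik jk p0_gt0 qv; have [[a0 b0] _ endb enda] := orb.
case: a a0 qv enda => [a'|//|]; last first.
  case: b b0 endb => [b'|_ _ _ qv _|//].
    move=> b0 /(_ b' erefl) nc _ qv _.
    apply: (far_motion_continuable m_gt0 ij ik jk H_lt0 p0_gt0 (e := b') _ _ nc).
      by rewrite -lte_fin.
    by move=> t t0 tb; apply: qv; rewrite ?ltNyr// lte_fin.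
  apply: (far_motion_not_entire p0_gt0 (q := q) (v := v)) => t.
  by apply: qv; rewrite ?ltNyr ?ltry.
move=> a0 qv /(_ a' erefl)/not_continuable_reversal nc.
apply: (far_motion_continuable m_gt0 ij ik jk H_lt0 p0_gt0 (e := - a') _ _ nc).
  by rewrite oppr_gt0 -lte_fin.
move=> t t0 ta; rewrite -[t]opprK; apply: far_motion_at_reversal; apply: qv.
  by rewrite lte_fin; lra.
by apply: le_lt_trans b0; rewrite lee_fin oppr_le0.
Qed.

Lemma binary_not_free k x : binary_collision k x -> ~ collision_free x.
Proof.
move=> [h _] cf; have [i [j [ij ik jk]]] := ord3_others k.
by have := cf i j ij; rewrite (h i j ik jk) eqxx.
Qed.

Lemma orbit_continuous t : (a < t%:E)%E -> (t%:E < b)%E -> {for t, continuous q}.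
Proof.
have [_ h _ _] := orb => at_ tb; case: (h t at_ tb) => [[_ [dq _] _]|[k [_ _ qt _ _]]//].
by apply: differentiable_continuous; exact/derivable1_diffP.
Qed.

Lemma near_lifespan t : (a < t%:E)%E -> (t%:E < b)%E ->
  \forall s \near t, (a < s%:E)%E /\ (s%:E < b)%E.
Proof.
move=> at_ tb.
have ha : \forall s \near t, (a < s%:E)%E.
  case: a at_ => [a'|//|_]; last by near=> s; rewrite ltNyr.
  rewrite lte_fin => at_.
  by apply: filterS (lt_nbhsr at_) => s; rewrite lte_fin.
have hb : \forall s \near t, (s%:E < b)%E.
  case: b tb => [b'|_|//]; last by near=> s; rewrite ltry.
  rewrite lte_fin => tb.
  by apply: filterS (lt_nbhsl tb) => s; rewrite lte_fin.
exact: filterI.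
Unshelve. all: by end_near. Qed.

Lemma regular_time t : (a < t%:E)%E -> (t%:E < b)%E -> collision_free (q t) ->
  level m H J (q t, v t) /\ newton m q v t.
Proof.
have [_ h _ _] := orb => at_ tb cf; case: (h t at_ tb) => [[lt dq dv]//|[k [bc]]].
by have := binary_not_free bc cf.
Qed.

Lemma near_collision_free t : {for t, continuous q} -> collision_free (q t) ->
  \forall s \near t, collision_free (q s).
Proof.
move=> qt cf.
near=> s => i; move: i; near: s; apply: filter_forall => i.
near=> s => j; move: j; near: s; apply: filter_forall => j.
have [->|ij] := eqVneq i j; first by near=> s; rewrite eqxx.
have h : dist (q s) i j @[s --> t] --> dist (q t) i j.
  by apply: cvg_enorm; apply: cvgB; exact: cvg_row.
have d0 : 0 < dist (q t) i j by rewrite enorm_gt0 subr_eq0 eq_sym cf.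
apply: filterS (cvgr_gt _ h _ d0) => s ds _.
by move: ds; rewrite enorm_gt0 subr_eq0 eq_sym.
Unshelve. all: by end_near. Qed.

Lemma near_shortest t k : {for t, continuous q} -> shortest k (q t) ->
  \forall s \near t, shortest k (q s).
Proof.
move=> qt sk.
near=> s => i; move: i; near: s; apply: filter_forall => i.
near=> s => j; move: j; near: s; apply: filter_forall => j.
have h l l' : dist (q s) l l' @[s --> t] --> dist (q t) l l'.
  by apply: cvg_enorm; apply: cvgB; exact: cvg_row.
case: (boolP [&& i != k, j != k & i != j]) => [/and3P[ik jk ij]|nijk]; last first.
  by near=> s => ik jk ij; move: nijk; rewrite ik jk ij.
have d0 : 0 < dist (q t) i k - dist (q t) i j by rewrite subr_gt0 sk.
apply: filterS (cvgr_gt _ (cvgB (h i k) (h i j)) _ d0) => s.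
by rewrite subr_gt0.
Unshelve. all: by end_near. Qed.

Lemma binary_shortest k x : binary_collision k x -> shortest k x.
Proof.
move=> [h hk] i j ik jk ij; rewrite /dist (h i j ik jk) subrr.
have -> : enorm (0 : 'rV[R]_3) = 0 by apply/eqP; rewrite enorm_eq0.
by rewrite enorm_gt0 subr_eq0 eq_sym hk.
Qed.

(** The sides facing k and k' both end at the third body, and each would be strictly shorter than
    the other. *)
Lemma shortest_uniq k k' x : shortest k x -> shortest k' x -> k = k'.
Proof.
move=> sk sk'; apply: contrapT => /eqP kk'.
have [l [lk lk']] : exists l : 'I_3, l != k /\ l != k'.
  move: kk'; case: k {sk} => [[|[|[|//]]]] ?; case: k' {sk'} => [[|[|[|//]]]] ? // _;
    by [exists b1 | exists b2 | exists b3].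
have k'k : k' != k by rewrite eq_sym.
have k'l : k' != l by rewrite eq_sym.
have kl : k != l by rewrite eq_sym.
have := sk l k' lk k'k lk'; have := sk' l k lk' kk' lk.
by move=> /lt_trans/[apply]; rewrite ltxx.
Qed.

(** Assumed at regular times only. Large inertia provides it, through the energy for the unspecified
    radius and through the decomposition into components for the explicit one. *)
Hypothesis cover : forall t, (a < t%:E)%E -> (t%:E < b)%E ->
  level m H J (q t, v t) -> exists k, shortest k (q t).

Lemma shortest_exists t : (a < t%:E)%E -> (t%:E < b)%E -> exists k, shortest k (q t).
Proof.
have [_ h _ _] := orb => at_ tb; case: (h t at_ tb) => [[lt _ _]|[k [bc _ _ _ _]]].
  exact: cover.
by exists k; exact: binary_shortest.
Qed.

(** At each time, collisions included, exactly one body faces the strictly shortest side, and it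
    still does at nearby times. For a given body this property is thus locally constant in time, and
    its equivalence at two times is a relation to which [interval_transP] applies. *)
Lemma shortest_constant k t : shortest k (q 0) -> (a < t%:E)%E -> (t%:E < b)%E ->
  shortest k (q t).
Proof.
have [[a0 b0] _ _ _] := orb => sk at_ tb.
have loc r : (a < r%:E)%E -> (r%:E < b)%E ->
    \forall x \near r, shortest k (q x) <-> shortest k (q r).
  move=> ar rb; have [k' sk'] := shortest_exists ar rb.
  apply: filterS (near_shortest (orbit_continuous ar rb) sk') => x skx.
  by split=> skk; [rewrite (shortest_uniq skk skx)|rewrite (shortest_uniq skk sk')].
pose P (x y : R) := shortest k (q x) <-> shortest k (q y).
have seg (s s' : R) : (a < s%:E)%E -> (s'%:E < b)%E -> s <= s' -> P s s'.
  move=> as_ s'b; apply: interval_transP => //.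
  - by move=> x y z; rewrite /P => ->.
  move=> r /andP[sr rs'].
  have ar : (a < r%:E)%E by apply: lt_le_trans as_ _; rewrite lee_fin.
  have rb : (r%:E < b)%E by apply: le_lt_trans s'b; rewrite lee_fin.
  by apply: filterS (loc r ar rb) => x hx; split=> _; rewrite /P hx.
have [t0|t0] := leP 0 t.
  exact: (seg 0 t a0 tb t0).1.
exact: (seg t 0 at_ b0 (ltW t0)).2.
Qed.

(** The common end of both claims: it remains to bound p below and to find the sign of p'' at
    regular times. *)
Lemma orbit_escapes_far k (p0 : R) : 0 < p0 -> shortest k (q 0) ->
  ~ (forall t, (a < t%:E)%E -> (t%:E < b)%E -> level m H J (q t, v t) ->
     shortest k (q t) -> p0 <= enorm (row k (q t)) /\ radial_force m k (q t) (v t) < 0).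
Proof.
move=> p0_gt0 sk0 bounds.
have [i [j [ij ik jk]]] := ord3_others k.
apply: (far_motion_not_orbit ij ik jk p0_gt0) => t at_ tb.
have far s : (a < s%:E)%E -> (s%:E < b)%E -> collision_free (q s) ->
    newton m q v s /\ far_state m k H p0 (q s) (v s).
  move=> as_ sb cf; have [ls ns] := regular_time as_ sb cf.
  have sk := shortest_constant sk0 as_ sb; have [pk rf] := bounds s as_ sb ls sk.
  by split=> //; case: ls => /= _ cx cv eH _; split.
have qt := orbit_continuous at_ tb.
have [_ h _ _] := orb; case: (h t at_ tb) => [[lt _ _]|[k' [bc cf _ vk _]]].
  have cft : collision_free (q t) by case: lt.
  split=> //; last by left; exact: far.
  apply: nbhs_dnbhs; near=> s.
  have [as_ sb] : (a < s%:E)%E /\ (s%:E < b)%E by near: s; exact: near_lifespan.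
  by apply: far => //; near: s; exact: near_collision_free.
(* A collision can only join i and j: the body left out by a collision faces the side of length
   0. *)
have E : k' = k by exact: shortest_uniq (binary_shortest bc) (shortest_constant sk0 at_ tb).
rewrite E in bc vk; split=> //; last first.
  by right; split; [exact: bc.1 | exists (lim (row k (v s) @[s --> t^']))].
near=> s.
have [as_ sb] : (a < s%:E)%E /\ (s%:E < b)%E.
  by near: s; apply: nbhs_dnbhs; exact: near_lifespan.
by apply: far => //; near: s.
Unshelve. all: by end_near. Qed.

End Orbit.

(** * Radii *)

Section CloseBinary.
Context {R : realType} {m : 'I_3 -> R} (m_gt0 : forall i, 0 < m i).
Context {i j k : 'I_3} (ij : i != j) (ik : i != k) (jk : j != k).
Context {H : R} (H_lt0 : H < 0) {J : 'rV[R]_3}.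

Local Notation mu' := (m i + m j).
Local Notation M := (m i + m j + m k).
Local Notation al := (m i * m j / (m i + m j)).
Local Notation be := (m k * (m i + m j + m k) / (m i + m j)).
Local Notation mm := (m i * m j + m i * m k + m j * m k).
Local Notation xi x := (row j x - row i x).

Let mu_gt0 : 0 < mu'. Proof. exact: addr_gt0. Qed.
Let al_gt0 : 0 < al. Proof. by rewrite divr_gt0 ?mulr_gt0. Qed.
Let be_gt0 : 0 < be. Proof. by rewrite divr_gt0 ?mulr_gt0 ?addr_gt0. Qed.
Let mm_gt0 : 0 < mm. Proof. by rewrite !addr_gt0 ?mulr_gt0. Qed.

(** With y the position of k and p >= 2 D, either attracting body l lies at distance at most K p,
    and y . (y - row l x) >= p^2 - p D >= p^2 / 2; its pull is therefore at least of order 1 / p^2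
    in the radial direction. *)
Lemma attraction_le (x : 'M[R]_3) (D : R) : \sum_i m i *: row i x = 0 ->
  collision_free x -> 0 < D -> dist x i j <= D -> 2 * D <= enorm (row k x) ->
  enorm (row k x) * dotv (row k x) (row k (accel m x))
    <= - (mu' / (2 * (M / mu' + 1) ^+ 3)).
Proof.
move=> cx cf D0 rD Dy; have ki : k != i by rewrite eq_sym.
have kj : k != j by rewrite eq_sym.
rewrite (row_accel _ _ ki kj ij) dotvDr !dotvZr.
set K := M / mu' + 1; set y := row k x in Dy *; set p := enorm y in Dy *.
have p_gt0 : 0 < p by lra.
have K1 : 1 <= M / mu' by rewrite ler_pdivlMr// mul1r lerDl ltW.
have K_gt0 : 0 < K by rewrite /K; lra.
have bnd l (c : R) : k != l -> `|c| <= 1 ->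
    y - row l x = (M / mu') *: y + c *: xi x ->
    p * (m l / dist x k l ^+ 3 * dotv y (row l x - y)) <= - (m l / (2 * K ^+ 3)).
  move=> kl c1 yl; have d_gt0 : 0 < dist x k l by rewrite enorm_gt0 subr_eq0 eq_sym cf.
  have cxi : enorm (c *: xi x) <= D.
    rewrite enormZ -[leRHS]mul1r; apply: ler_pM => //; exact: enorm_ge0.
  have dK : dist x k l <= K * p.
    rewrite distC /dist yl; apply: le_trans (ler_enormD _ _) _.
    rewrite enormZ ger0_norm; last lra.
    by rewrite /K [leRHS]mulrDl mul1r -/p lerD2l; lra.
  have ylow : p ^+ 2 / 2 <= dotv y (y - row l x).
    rewrite yl dotvDr dotvZr -sqr_enorm -/p.
    have := le_trans (cauchy_schwarz y (c *: xi x)) (ler_wpM2l (enorm_ge0 y) cxi).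
    rewrite -/p ler_norml => /andP[lo _].
    have : p ^+ 2 <= M / mu' * p ^+ 2 by rewrite ler_peMl// sqr_ge0.
    have : p * D <= p ^+ 2 / 2.
      by rewrite expr2 -mulrA ler_pM2l//; lra.
    lra.
  rewrite -opprB dotvNr !mulrN lerN2.
  apply: (@le_trans _ _ (p * (m l / (K * p) ^+ 3 * (p ^+ 2 / 2)))).
    rewrite le_eqVlt; apply/orP; left; apply/eqP.
    by field; rewrite !gt_eqF.
  rewrite ler_pM2l//; apply: ler_pM => //.
  - by rewrite divr_ge0 ?exprn_ge0 ?mulr_ge0// ltW.
  - by rewrite divr_ge0 ?sqr_ge0.
  - rewrite ler_pM2l// lef_pV2 ?posrE ?exprn_gt0 ?mulr_gt0//.
    by rewrite lerXn2r ?nnegrE ?mulr_ge0// ltW.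
rewrite mulrDr.
have bi : `|m j / mu'| <= 1.
  by rewrite ger0_norm ?divr_ge0 ?ltW// ltr_pdivrMr// mul1r ltrDr.
have bj : `|- (m i / mu')| <= 1.
  by rewrite normrN ger0_norm ?divr_ge0 ?ltW// ltr_pdivrMr// mul1r ltrDl.
have hi := bnd i _ ki bi (centered_diffi m_gt0 ij ik jk cx).
have hj : p * (m j / dist x k j ^+ 3 * dotv y (row j x - y)) <= - (m j / (2 * K ^+ 3)).
  apply: bnd kj bj _; rewrite scaleNr; exact: (centered_diffj m_gt0 ij ik jk cx).
apply: le_trans (lerD hi hj) _.
by rewrite -opprD -mulrDl.
Qed.

(** The angular momentum of the outer motion is J minus that of the pair, and the latter is O(sqrt
    D) by [pair_velocity_le]. *)
Lemma outer_momentum_le (x v : 'M[R]_3) (D : R) : level m H J (x, v) ->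
  shortest k x -> 0 < D -> dist x i j <= D ->
  be * enorm (crossv (row k x) (row k v))
    <= enorm J + al * Num.sqrt (2 * mm / al * D).
Proof.
move=> [/= cf cx cv eH aJ] sx D0 rD.
have -> : be * enorm (crossv (row k x) (row k v))
    = enorm (J - al *: crossv (xi x) (xi v)).
  rewrite -aJ (angmomE m_gt0 ij ik jk cx cv) [al *: _ + _]addrC addrK enormZ gtr0_norm//.
apply: le_trans (ler_enormB _ _) _; rewrite lerD2l enormZ gtr0_norm// ler_pM2l//.
apply: le_trans (enorm_crossv_le _ _) _.
rewrite -[leLHS]ger0_norm; last by rewrite mulr_ge0 ?enorm_ge0.
rewrite -sqrtr_sqr; apply: ler_wsqrtr.
apply: le_trans (pair_velocity_le m_gt0 ij ik jk H_lt0 cf cv eH sx) _.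
by rewrite ler_pM2l// divr_gt0// mulr_gt0.
Qed.

Lemma far_bounds (D : R) : 0 < D -> exists Rk : R, 0 < Rk /\
  forall x v, level m H J (x, v) -> Rk < inertia m x -> dist x i j <= D ->
    [/\ shortest k x, 1 <= enorm (row k x) & radial_force m k x v < 0].
Proof.
move=> D0; pose C := (enorm J + al * Num.sqrt (2 * mm / al * D)) / be.
(* [C] bounds |row k x x row k v|. In [N], the 1 serves the bound on p, 2 D allows [attraction_le],
   and the last term makes p mu' / (2 K^3) exceed C^2. *)
pose K := M / mu' + 1; pose N := 1 + 2 * D + 2 * K ^+ 3 * C ^+ 2 / mu'.
have K1 : 1 <= M / mu' by rewrite ler_pdivlMr// mul1r lerDl ltW.
have K_gt0 : 0 < K by rewrite /K; lra.
have C2 : 0 <= 2 * K ^+ 3 * C ^+ 2 / mu'.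
  by rewrite divr_ge0 ?(ltW mu_gt0)// mulr_ge0 ?sqr_ge0// mulr_ge0// exprn_ge0// ltW.
have N1 : 1 <= N by rewrite /N; lra.
(* The pair contributes at most [al * D ^+ 2] to the inertia, so the remainder forces p > N. *)
exists (al * D ^+ 2 + be * N ^+ 2); split.
  by rewrite addr_gt0// mulr_gt0// exprn_gt0//; lra.
move=> x v lxv; have [/= cf cx cv eH aJ] := lxv.
rewrite (inertiaE m_gt0 ij ik jk cx) => Ix rD.
have yN : N < enorm (row k x).
  have : al * enorm (xi x) ^+ 2 <= al * D ^+ 2.
    by rewrite ler_pM2l// lerXn2r ?nnegrE ?enorm_ge0// ltW.
  move=> h; have {h} : be * N ^+ 2 < be * enorm (row k x) ^+ 2 by lra.
  by rewrite ltr_pM2l// ltr_sqr ?nnegrE ?enorm_ge0// (le_trans ler01 N1).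
have y2D : 2 * D < enorm (row k x) by apply: lt_trans yN; rewrite /N; lra.
have far l (c : R) : `|c| <= 1 -> row k x - row l x = (M / mu') *: row k x + c *: xi x ->
    dist x i j < dist x l k.
  move=> c1 E; rewrite {2}/dist E; apply: (le_lt_trans rD).
  apply: lt_le_trans (lerB_enormD _ _); rewrite !enormZ (ger0_norm (x := M / _)); last lra.
  have : `|c| * enorm (xi x) <= 1 * D by rewrite ler_pM ?enorm_ge0.
  have : enorm (row k x) <= M / mu' * enorm (row k x) by rewrite ler_peMl// enorm_ge0.
  lra.
have sx : shortest k x.
  apply: (shortest_intro ij ik jk).
    apply: far (centered_diffi m_gt0 ij ik jk cx).
    by rewrite ger0_norm ?divr_ge0 ?ltW// ltr_pdivrMr// mul1r ltrDr.
  apply: (far j (- (m i / mu'))).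
    by rewrite normrN ger0_norm ?divr_ge0 ?ltW// ltr_pdivrMr// mul1r ltrDl.
  by rewrite scaleNr; exact: (centered_diffj m_gt0 ij ik jk cx).
split=> //; first lra.
have hC : enorm (crossv (row k x) (row k v)) <= C.
  by rewrite ler_pdivlMr// mulrC; exact: outer_momentum_le.
have hA := attraction_le cx cf D0 rD (ltW y2D); rewrite -/K in hA.
rewrite /radial_force expr2 (expr2 (enorm (row k x))) -mulrA.
have y_gt0 : 0 < enorm (row k x) by lra.
have := ler_wpM2l (ltW y_gt0) hA.
have : enorm (crossv (row k x) (row k v)) * enorm (crossv (row k x) (row k v)) <= C ^+ 2.
  by rewrite expr2; apply: ler_pM => //; exact: enorm_ge0.
have : C ^+ 2 < enorm (row k x) * (mu' / (2 * K ^+ 3)).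
  rewrite -ltr_pdivrMr ?divr_gt0 ?mulr_gt0 ?exprn_gt0// invf_div mulrA.
  by apply: lt_trans yN; rewrite /N mulrC; lra.
set A := enorm (row k x) * (mu' / _); rewrite mulrN -/A.
lra.
Qed.

End CloseBinary.

(** * Gradient of the perturbing potential *)

Section PotentialGradient.
Context {R : realType}.

(** Restriction to a line: directional derivatives, hence [grad], become accessible to the
    one-variable rules. *)
Lemma is_derive_line {V W : normedModType R} (f : V -> W) (x u : V) (df : W) :
  is_derive (0 : R) 1 (fun h : R => f (h *: u + x)) df -> is_derive x u f df.
Proof.
case=> d1 <-; apply: DeriveDef; first exact/derivable1P.
have E : (fun h : R => h^-1 *: ((f \o shift x) (h *: u) - f x)) =
    (fun h => h^-1 *: (((fun h : R => f (h *: u + x)) \o shift 0) (h *: (1 : R))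
                       - f ((0 : R) *: u + x))).
  apply/funext => h; have -> : h *: (1 : R) = h by exact: mulr1.
  by rewrite /= addr0 scale0r add0r.
by rewrite /derive E.
Qed.

Lemma is_derive_inv_enorm (x z u : 'rV[R]_3) : x + z != 0 ->
  is_derive x u (fun y => (enorm (y + z))^-1) (- (dotv (x + z) u / enorm (x + z) ^+ 3)).
Proof.
move=> xz0; apply: is_derive_line.
have dl : is_derive (0 : R) 1 (fun h : R => h *: u + x + z) u.
  apply/is_derive_mxP => a c.
  have h1 : is_derive (0 : R) 1 (fun h : R => h * u a c + (x a c + z a c))
      ((0 : R) *: (0 : R) + u a c *: (1 : R) + 0).
    apply: is_deriveD; exact: is_deriveM.
  move: h1; rewrite scale0r add0r addr0 /GRing.scale/= mulr1 => h1.
  by under eq_fun do rewrite !mxE -addrA.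
have xz : 0 *: u + x + z = x + z by rewrite scale0r add0r.
have n0 : 0 *: u + x + z != 0 by rewrite xz.
have e0 : enorm (x + z) != 0 by rewrite enorm_eq0.
have d1 := is_derive_enorm dl n0.
have e1 : enorm (0 *: u + x + z) != 0 by rewrite xz.
have := @is_deriveV _ (fun h : R => enorm (h *: u + x + z)) _ _ _ e1 d1.
move/is_derive_eq; apply; rewrite xz /GRing.scale/=.
by field.
Qed.

Lemma dotv_delta (x : 'rV[R]_3) c : dotv x (delta_mx 0 c) = x 0 c.
Proof.
rewrite /dotv (bigD1 c)//= mxE !eqxx mulr1 big1 ?addr0// => l lc.
by rewrite mxE (negbTE lc) andbF mulr0.
Qed.

Lemma grad_gpert (m : 'I_3 -> R) (y1 y2 : 'rV[R]_3) :
  let z1 := y2 + (m b2 / mu m) *: y1 in let z2 := y2 - (m b1 / mu m) *: y1 in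
  y2 != 0 -> z1 != 0 -> z2 != 0 ->
  grad (gpert m y1) y2 = - (beta2 m / enorm y2 ^+ 3) *: y2
    + (m b1 * m b3 / enorm z1 ^+ 3) *: z1 + (m b2 * m b3 / enorm z2 ^+ 3) *: z2.
Proof.
move=> z1 z2 y0 z10 z20; apply/rowP => c; rewrite !mxE.
pose u : 'rV[R]_3 := delta_mx 0 c.
have d0 : is_derive y2 u (fun y => (enorm y)^-1) (- (dotv y2 u / enorm y2 ^+ 3)).
  have := @is_derive_inv_enorm y2 0 u; rewrite addr0 => /(_ y0).
  by under eq_fun do rewrite addr0.
have d1 := @is_derive_inv_enorm y2 ((m b2 / mu m) *: y1) u z10.
have d2 := @is_derive_inv_enorm y2 (- ((m b1 / mu m) *: y1)) u z20.
have := is_deriveB (is_deriveB (is_deriveZ (beta2 m) d0)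
  (is_deriveZ (m b1 * m b3) d1)) (is_deriveZ (m b2 * m b3) d2).
case=> _; rewrite -/z1 -/z2 !dotv_delta /GRing.scale/= => E.
transitivity ('D_u (gpert m y1) y2); first by [].
rewrite E; move: (enorm y2 ^+ 3) (enorm z1 ^+ 3) (enorm z2 ^+ 3) => e e1 e2.
rewrite /z1 /z2 !mxE; ring.
Qed.

End PotentialGradient.

Lemma component_shortest {R : realType} (m : 'I_3 -> R) H J Is k (s : 'M[R]_3 * 'M[R]_3) :
  component m H J Is k s -> shortest k s.1.
Proof. by case. Qed.

(** * A radius valid for all three components *)

Section UniformRadius.
Context {R : realType} {m : 'I_3 -> R} (m_gt0 : forall i, 0 < m i).
Context {H : R} (H_lt0 : H < 0) {J : 'rV[R]_3}.

(** One length for all labelings: the square of the total mass strictly exceeds the sum of the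
    products of pairs, so D exceeds the bound of [shortest_le] whichever side is the shortest. *)
Local Notation D := ((\sum_l m l) ^+ 2 / - H).

Let S2_gt (i j k : 'I_3) : i != j -> i != k -> j != k ->
  m i * m j + m i * m k + m j * m k < (\sum_l m l) ^+ 2.
Proof.
move=> ij ik jk; rewrite (sum_distinct _ ij ik jk).
have := m_gt0 i; have := m_gt0 j; have := m_gt0 k.
move: (m i) (m j) (m k) => x y z; nra.
Qed.

Let S2_gt0 : 0 < (\sum_l m l) ^+ 2.
Proof.
have := @S2_gt b1 b2 b3 isT isT isT; apply: lt_trans.
by rewrite !addr_gt0 ?mulr_gt0.
Qed.

Let D_gt0 : 0 < D. Proof. by rewrite divr_gt0 ?oppr_gt0. Qed.

Let close k (x : 'M[R]_3) : Prop :=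
  forall i j, i != k -> j != k -> i != j -> dist x i j <= D.

Let closeI (i j k : 'I_3) x : i != j -> i != k -> j != k -> dist x i j <= D -> close k x.
Proof.
move=> ij ik jk dD i' j' + +.
have [->|->|->] := ord3_distinct i' ij ik jk;
  have [->|->|->] := ord3_distinct j' ij ik jk; rewrite ?eqxx// => _ _ _.
by rewrite distC.
Qed.

(** If all three sides exceeded D, the potential term would be less than - H, and the energy greater
    than H. *)
Lemma level_close x v : level m H J (x, v) -> exists k, close k x.
Proof.
case=> /= cf _ _ eH _.
have e12 : b1 != b2 by []. have e13 : b1 != b3 by []. have e23 : b2 != b3 by [].
have [d12|d12] := leP (dist x b1 b2) D; first by exists b3; exact: closeI d12.
have [d13|d13] := leP (dist x b1 b3) D; first by exists b2; exact: closeI d13.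
have [d23|d23] := leP (dist x b2 b3) D; first by exists b1; exact: closeI d23.
have bnd (c d : R) : 0 < c -> D < d -> c / d <= c / D.
  move=> c0 Dd; rewrite ler_pM2l// lef_pV2 ?posrE//; first exact: ltW.
  exact: lt_trans Dd.
have := eH; rewrite (energyE e12 e13 e23).
have := inertia_ge0 m_gt0 v.
have := bnd _ _ (mulr_gt0 (m_gt0 b1) (m_gt0 b2)) d12.
have := bnd _ _ (mulr_gt0 (m_gt0 b1) (m_gt0 b3)) d13.
have := bnd _ _ (mulr_gt0 (m_gt0 b2) (m_gt0 b3)) d23.
have : (m b1 * m b2 + m b1 * m b3 + m b2 * m b3) / D < - H.
  rewrite ltr_pdivrMr// (mulrC (- H)) divfK ?gt_eqF ?oppr_gt0//.
  exact: S2_gt.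
rewrite !mulrDl; lra.
Qed.

Lemma shortest_close x v k : level m H J (x, v) -> shortest k x -> close k x.
Proof.
case=> /= cf _ _ eH _ sx i j ik jk ij.
apply: le_trans (shortest_le m_gt0 ij ik jk H_lt0 cf eH sx) _.
by rewrite ler_pM2r ?invr_gt0 ?oppr_gt0// ltW// S2_gt.
Qed.

Lemma uniform_radius : exists2 Rl : R, 0 < Rl &
  forall (a b : \bar R) (q v : R -> 'M[R]_3), three_body_orbit m H J a b q v ->
    exists t : R, [/\ (a < t%:E)%E, (t%:E < b)%E & inertia m (q t) <= Rl].
Proof.
have FB k : exists Rk : R, 0 < Rk /\ forall x v, level m H J (x, v) ->
    Rk < inertia m x -> close k x ->
    [/\ shortest k x, 1 <= enorm (row k x) & radial_force m k x v < 0].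
  have [i [j [ij ik jk]]] := ord3_others k.
  have [Rk [Rk0 h]] := @far_bounds R m m_gt0 i j k ij ik jk H H_lt0 J D D_gt0.
  by exists Rk; split=> // x v lx Ix cx; apply: h => //; exact: cx.
(* Being positive, the three radii are each dominated by their sum, which therefore serves every
   choice of k. *)
have [Rf hR] := choice FB; exists (\sum_k Rf k).
  rewrite (@sum_distinct _ b1 b2 b3)//.
  by have [r1 _] := hR b1; have [r2 _] := hR b2; have [r3 _] := hR b3; rewrite !addr_gt0.
move=> a b q v orb; apply: contrapT => no.
have big t : (a < t%:E)%E -> (t%:E < b)%E -> \sum_k Rf k < inertia m (q t).
  by move=> at_ tb; rewrite ltNge; apply/negP => It; apply: no; exists t.
have bigk k t : (a < t%:E)%E -> (t%:E < b)%E -> Rf k < inertia m (q t).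
  move=> at_ tb; apply: le_lt_trans (big t at_ tb).
  rewrite (bigD1 k)//= lerDl; apply: sumr_ge0 => l _.
  by have [/ltW] := hR l.
have cover t : (a < t%:E)%E -> (t%:E < b)%E -> level m H J (q t, v t) ->
    exists k, shortest k (q t).
  move=> at_ tb lt; have [k ck] := level_close lt; exists k.
  by have [_ /(_ _ _ lt (bigk k t at_ tb) ck)[]] := hR k.
have [[a0 b0] _ _ _] := orb.
have [k sk] := shortest_exists orb cover a0 b0.
apply: (orbit_escapes_far m_gt0 H_lt0 orb cover ltr01 sk) => t at_ tb lt skt.
by have [_ /(_ _ _ lt (bigk k t at_ tb) (shortest_close lt skt))[]] := hR k.
Qed.

End UniformRadius.

(** * The explicit radius *)

Section ExplicitRadius.
Context {R : realType} {m : 'I_3 -> R} (m_gt0 : forall i, 0 < m i).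
Context {H : R} (H_lt0 : H < 0) {J : 'rV[R]_3} {c : constants R} {lambda : R}.
Hypothesis (lambda_gt0 : 0 < lambda) (adm : admissible m H J c).

Let mu_gt0 : 0 < mu m. Proof. exact: addr_gt0. Qed.
Let M_gt0 : 0 < Mtot m. Proof. by rewrite !addr_gt0. Qed.
Let alpha1_gt0 : 0 < alpha1 m. Proof. by rewrite divr_gt0 ?mulr_gt0. Qed.
Let alpha2_gt0 : 0 < alpha2 m. Proof. by rewrite divr_gt0 ?mulr_gt0. Qed.

Let c_gt0 : [/\ 0 < Istar c, 0 < c_g c, 0 < c_g2 c, 0 < c_J2 c & 0 < c_r c].
Proof. by case: adm. Qed.

Let cA_ge0 : 0 <= cA m c.
Proof.
case: c_gt0 => _ _ h2 _ hr.
by rewrite /cA mulr_ge0 ?sqr_ge0// mulr_ge0 ?(ltW h2)// invr_ge0 ltW.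
Qed.

(** [cA] is one of the nonnegative summands of [ca], and the factor containing the exponential is at
    least 2. This lets a bound rho^2 > 4 A_1 control the perturbing force. *)
Lemma cA1_ge : 2 * cA m c <= Mtot m * cA1 m c.
Proof.
case: c_gt0 => _ _ _ hJ _.
have B0 : 0 <= cB1 m by rewrite /cB1 !mulr_ge0 ?powR_ge0 ?pi_ge0 ?invr_ge0 ?sqrtr_ge0.
have aA : cA m c <= ca m c.
  rewrite /ca lerDr addr_ge0 ?sqr_ge0// mulr_ge0// mulr_ge0//.
  by rewrite mulr_ge0// ltW.
rewrite /cA1 mulrA (mulrC (Mtot m)) divfK ?gt_eqF// mulrC.
apply: ler_pM => //.
by rewrite lerDl expR_ge0.
Qed.

(** In the last bound, 4 alpha_2 A_1 adds up the 2 alpha_2 A_1 present in [Rbar_lambda] and the one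
    added in [R_lambda]. The term alpha_1 c_r^2 is the largest share of the inertia that the pair
    can take. Strictness comes from lambda > 0. *)
Lemma R_lambda_ge :
  [/\ Istar c < R_lambda m c lambda,
      alpha1 m * c_r c ^+ 2
        + Num.max 1 ((3 * c_J2 c ^+ 2 / (2 * Mtot m)) ^+ 2) * alpha2 m
        < R_lambda m c lambda
    & alpha1 m * c_r c ^+ 2 + 4 * alpha2 m * cA1 m c < R_lambda m c lambda].
Proof.
have A10 : 0 <= cA1 m c.
  have : 0 <= Mtot m * cA1 m c by apply: le_trans cA1_ge; rewrite mulr_ge0.
  by rewrite pmulr_rge0.
have aA : 0 <= 2 * alpha2 m * cA1 m c by rewrite mulr_ge0// mulr_ge0// ltW.
have ar : 0 <= alpha1 m * c_r c ^+ 2 by rewrite mulr_ge0 ?sqr_ge0// ltW.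
have Rb : Rbar m c <= Rbar_lambda m c lambda
  by rewrite /Rbar_lambda le_max; apply/orP; left; rewrite le_max lexx.
have R1 : Istar c <= Rbar m c by rewrite /Rbar le_max lexx.
have R2 : alpha1 m * c_r c ^+ 2
    + Num.max 1 ((3 * c_J2 c ^+ 2 / (2 * Mtot m)) ^+ 2) * alpha2 m <= Rbar m c.
  by rewrite /Rbar le_max lexx orbT.
have R3 : 2 * alpha2 m * cA1 m c + 4 * alpha1 m * c_r c ^+ 2 + lambda
    <= Rbar_lambda m c lambda.
  by rewrite /Rbar_lambda le_max; apply/orP; right; rewrite le_max lexx orbT.
have l0 := lambda_gt0; rewrite /R_lambda; split; [lra|lra|].
have : 4 * alpha1 m * c_r c ^+ 2 = 4 * (alpha1 m * c_r c ^+ 2) by rewrite mulrA.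
have : 4 * alpha2 m * cA1 m c = 2 * (2 * alpha2 m * cA1 m c) by ring.
lra.
Qed.

Lemma R_lambda_gt0 : 0 < R_lambda m c lambda.
Proof. by case: c_gt0 R_lambda_ge => h _ _ _ _ [] /(lt_trans h). Qed.

Lemma xi2E (x : 'M[R]_3) : \sum_i m i *: row i x = 0 ->
  xi2 m x = (Mtot m / mu m) *: row b3 x.
Proof.
rewrite (@sum_distinct _ b1 b2 b3)// /xi2 => h.
have -> : m b1 *: row b1 x + m b2 *: row b2 x = - (m b3 *: row b3 x).
  by apply/eqP; rewrite -subr_eq0 opprK h.
rewrite /Mtot; apply/rowP => l; rewrite !mxE.
by rewrite -/(mu m); field; rewrite gt_eqF.
Qed.

(** The Jacobi equation of motion of xi_2, whose acceleration is M / mu times that of the third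
    body. It links the actual force in [radial_force] to the gradient bounded in [admissible]. *)
Lemma outer_force (x : 'M[R]_3) : \sum_i m i *: row i x = 0 -> collision_free x ->
  xi2 m x != 0 ->
  (alpha2 m * (Mtot m / mu m)) *: row b3 (accel m x)
  = - (beta2 m / enorm (xi2 m x) ^+ 3) *: xi2 m x - grad (gpert m (xi1 x)) (xi2 m x).
Proof.
move=> cx cf x20.
have e12 : b1 != b2 by []. have e13 : b1 != b3 by []. have e23 : b2 != b3 by [].
have z1E : xi2 m x + (m b2 / mu m) *: xi1 x = row b3 x - row b1 x.
  by rewrite xi2E// (centered_diffi m_gt0 e12 e13 e23 cx).
have z2E : xi2 m x - (m b1 / mu m) *: xi1 x = row b3 x - row b2 x.
  by rewrite xi2E// (centered_diffj m_gt0 e12 e13 e23 cx).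
rewrite (@grad_gpert _ m (xi1 x) (xi2 m x)) ?z1E ?z2E//; first last.
- by rewrite subr_eq0 cf.
- by rewrite subr_eq0 cf.
have e31 : b3 != b1 by []. have e32 : b3 != b2 by [].
rewrite (row_accel m x e31 e32 e12) -/(dist x b1 b3) -/(dist x b2 b3).
rewrite (distC x b3 b1) (distC x b3 b2).
rewrite opprD opprD addrA addrA scaleNr opprK addNr add0r.
have -> : alpha2 m * (Mtot m / mu m) = m b3.
  by rewrite /alpha2; field; rewrite !gt_eqF.
apply/rowP => l; rewrite !mxE.
move: (dist x b1 b3 ^+ 3) (dist x b2 b3 ^+ 3) => A B; ring.
Qed.

(** Removing the share of the pair from the inertia leaves three lower bounds: rho > 1, which is p >
    mu / M; rho > 3 c_J2^2 / (2 M), against the centrifugal term; rho^2 > 4 A_1, against the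
    perturbation. *)
Lemma explicit_bounds x v : component m H J (Istar c) b3 (x, v) ->
  R_lambda m c lambda < inertia m x ->
  mu m / Mtot m <= enorm (row b3 x) /\ radial_force m b3 x v < 0.
Proof.
move=> comp Ix; have [_ _ /(_ _ comp)[_ /= gB JB rB]] := adm.
have [[[/= cf cx cv eH aJ] _] _] := comp.
have e12 : b1 != b2 by []. have e13 : b1 != b3 by []. have e23 : b2 != b3 by [].
have [_ _ hg hJ hr] := c_gt0.
have k_gt0 : 0 < Mtot m / mu m by rewrite divr_gt0.
have x2E := xi2E cx; have v2E := xi2E cv.
set rho := enorm (xi2 m x) in gB *.
have rhoE : rho = Mtot m / mu m * enorm (row b3 x).
  by rewrite /rho x2E enormZ gtr0_norm.
have inE : inertia m x = alpha1 m * enorm (xi1 x) ^+ 2 + alpha2 m * rho ^+ 2.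
  rewrite (inertiaE m_gt0 e12 e13 e23 cx) rhoE; congr (_ + _).
  by rewrite /alpha2 /Mtot -/(mu m); field; rewrite -/(Mtot m) !gt_eqF.
have [_ R2 R3] := R_lambda_ge.
have rr : alpha1 m * enorm (xi1 x) ^+ 2 <= alpha1 m * c_r c ^+ 2.
  by rewrite ler_pM2l// lerXn2r ?nnegrE ?enorm_ge0// ltW.
have rho_ge0 : 0 <= rho by exact: enorm_ge0.
have rho2 : Num.max 1 ((3 * c_J2 c ^+ 2 / (2 * Mtot m)) ^+ 2) < rho ^+ 2.
  by rewrite -(ltr_pM2l alpha2_gt0) (mulrC (alpha2 m)); lra.
have rhoA : 4 * cA1 m c < rho ^+ 2.
  by rewrite -(ltr_pM2l alpha2_gt0) mulrCA mulrA; lra.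
move: rho2; rewrite gt_max => /andP[rho1 rhoJ].
have {}rho1 : 1 < rho.
  by rewrite -(ltr_pXn2r (n := 2)) ?nnegrE// expr1n.
have {}rhoJ : 3 * c_J2 c ^+ 2 / (2 * Mtot m) < rho.
  rewrite -(ltr_pXn2r (n := 2)) ?nnegrE//.
  by rewrite divr_ge0 ?mulr_ge0 ?sqr_ge0// ltW.
split.
  rewrite -(ler_pM2l k_gt0) -rhoE mulrA divfK ?gt_eqF// divff ?gt_eqF//.
  exact: ltW.
have rho_gt0 : 0 < rho by lra.
set k := Mtot m / mu m in k_gt0 x2E v2E rhoE *.
have torque : k ^+ 2 * enorm (crossv (row b3 x) (row b3 v)) <= c_J2 c.
  rewrite -(ler_pM2l alpha2_gt0); apply: le_trans JB.
  rewrite /J2 /= x2E v2E crossvZl crossvZr !enormZ !gtr0_norm//.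
  by rewrite le_eqVlt; apply/orP; left; apply/eqP; ring.
have x20 : xi2 m x != 0 by rewrite -enorm_gt0.
have force := outer_force cx cf x20; rewrite -/k -/rho in force.
have pull : alpha2 m * (rho * (k * dotv (xi2 m x) (row b3 (accel m x))))
    <= - beta2 m + alpha2 m * (cA m c / rho ^+ 2).
  have -> : alpha2 m * (rho * (k * dotv (xi2 m x) (row b3 (accel m x)))) =
      rho * dotv (xi2 m x) ((alpha2 m * k) *: row b3 (accel m x)).
    by rewrite dotvZr; ring.
  rewrite force dotvDr dotvZr dotvNr -sqr_enorm -/rho mulrDr.
  rewrite (_ : rho * (- (beta2 m / rho ^+ 3) * rho ^+ 2) = - beta2 m); last first.
    by field; rewrite gt_eqF.
  rewrite lerD2l mulrN; set G := grad _ _ in gB *.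
  have cs := cauchy_schwarz (xi2 m x) G; rewrite -/rho in cs.
  have {}cs : - dotv (xi2 m x) G <= rho * (c_g2 c * c_r c ^+ 2 / rho ^+ 4).
    have r2 : c_g2 c * enorm (xi1 x) ^+ 2 / rho ^+ 4 <= c_g2 c * c_r c ^+ 2 / rho ^+ 4.
      rewrite ler_pM2r ?invr_gt0 ?exprn_gt0// ler_pM2l//.
      by rewrite lerXn2r ?nnegrE ?enorm_ge0// ltW.
    apply: le_trans (ler_norm _) _; rewrite normrN; apply: (le_trans cs).
    by rewrite ler_pM2l//; exact: le_trans gB r2.
  rewrite -mulrN; apply: le_trans (ler_wpM2l rho_ge0 cs) _.
  rewrite le_eqVlt; apply/orP; left; apply/eqP; rewrite /cA.
  by field; rewrite !gt_eqF.
have goal : c_J2 c ^+ 2 + rho * (rho * (k * dotv (xi2 m x) (row b3 (accel m x)))) < 0.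
  have {}pull : rho * (k * dotv (xi2 m x) (row b3 (accel m x)))
      <= - Mtot m + cA m c / rho ^+ 2.
    rewrite -(ler_pM2l alpha2_gt0); apply: le_trans pull _.
    by rewrite mulrDr mulrN /beta2 (mulrC (Mtot m)).
  have h1 := ler_wpM2l rho_ge0 pull.
  have h2 : c_J2 c ^+ 2 < rho * (2 / 3 * Mtot m).
    rewrite -ltr_pdivrMr ?mulr_gt0 ?divr_gt0//.
    have -> // : c_J2 c ^+ 2 / (2 / 3 * Mtot m) = 3 * c_J2 c ^+ 2 / (2 * Mtot m).
    by field; rewrite gt_eqF.
  (* From rho^2 > 4 A_1 and M A_1 >= 2 A one gets A < M rho^2 / 8, more than enough. *)
  have h3 : rho * (cA m c / rho ^+ 2) < rho * (Mtot m / 3).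
    rewrite ltr_pM2l// ltr_pdivrMr ?exprn_gt0//.
    have := cA1_ge; have : Mtot m * (4 * cA1 m c) < Mtot m * rho ^+ 2 by rewrite ltr_pM2l.
    have := mulr_gt0 M_gt0 (exprn_gt0 2 rho_gt0).
    have := cA_ge0; rewrite mulrCA; lra.
  move: h1; rewrite mulrDr mulrN; lra.
(* Passing from the third body to xi_2 multiplies position, velocity and acceleration by k, and both
   terms of [radial_force] are homogeneous of degree 4. *)
suff : k ^+ 4 * radial_force m b3 x v < 0 by rewrite pmulr_rlt0// exprn_gt0.
apply: le_lt_trans goal; rewrite /radial_force mulrDr; apply: lerD.
  rewrite (_ : k ^+ 4 * _ = (k ^+ 2 * enorm (crossv (row b3 x) (row b3 v))) ^+ 2).
    by rewrite lerXn2r ?nnegrE ?(ltW hJ)// mulr_ge0 ?sqr_ge0 ?enorm_ge0.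
  by ring.
rewrite x2E dotvZl rhoE le_eqVlt; apply/orP; left; apply/eqP; ring.
Qed.

Lemma explicit_radius (a b : \bar R) (q v : R -> 'M[R]_3) :
  three_body_orbit m H J a b q v -> starts_in_component m H J (Istar c) b3 q v ->
  exists t : R, [/\ (a < t%:E)%E, (t%:E < b)%E & inertia m (q t) <= R_lambda m c lambda].
Proof.
move=> orb start; apply: contrapT => no.
have big t : (a < t%:E)%E -> (t%:E < b)%E -> R_lambda m c lambda < inertia m (q t).
  by move=> at_ tb; rewrite ltNge; apply/negP => It; apply: no; exists t.
have [IsR _ _] := R_lambda_ge.
have reg t : (a < t%:E)%E -> (t%:E < b)%E -> level m H J (q t, v t) ->
    exists k, component m H J (Istar c) k (q t, v t).
  move=> at_ tb lt; have [_ [cov _] _] := adm.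
  have : region m H J (Istar c) (q t, v t).
    by split=> //=; exact: lt_trans IsR (big t at_ tb).
  by rewrite cov => -[k _ ck]; exists k.
have cover t : (a < t%:E)%E -> (t%:E < b)%E -> level m H J (q t, v t) ->
    exists k, shortest k (q t).
  by move=> at_ tb /(reg t at_ tb)[k /component_shortest sk]; exists k.
have [[a0 b0] _ _ _] := orb.
(* The starting condition concerns times near 0 but different from 0. The body facing the shortest
   side at time 0 still faces it at such times, where uniqueness identifies it with [b3]. *)
have sk : shortest b3 (q 0).
  have [k sk] := shortest_exists orb cover a0 b0.
  have near0 := near_shortest (orbit_continuous orb a0 b0) sk.
  near (0 : R)^' => s.
  have s3 : shortest b3 (q s).
    by apply: (@component_shortest _ m H J (Istar c) _ (q s, v s)); near: s.
  have sks : shortest k (q s) by near: s; exact: nbhs_dnbhs.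
  by rewrite (shortest_uniq s3 sks).
have p0_gt0 : 0 < mu m / Mtot m by rewrite divr_gt0.
apply: (orbit_escapes_far m_gt0 H_lt0 orb cover p0_gt0 sk) => t at_ tb lt s3.
apply: explicit_bounds (big t at_ tb).
have [k ck] := reg t at_ tb lt.
by rewrite (shortest_uniq s3 (component_shortest ck)).
Unshelve. all: by end_near. Qed.

End ExplicitRadius.

Theorem proposition18 (R : realType) (m : 'I_3 -> R)
    (m_gt0 : forall i, 0 < m i) (H : R) (H_lt0 : H < 0) (J : 'rV[R]_3)
    (lambda : R) (lambda_gt0 : 0 < lambda) :
  (exists2 Rl : R, 0 < Rl &
     forall (a b : \bar R) (q v : R -> 'M[R]_3),
       three_body_orbit m H J a b q v -> Rl <= inertia m (q 0) ->
       exists t : R,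
         [/\ (a < t%:E)%E, (t%:E < b)%E & inertia m (q t) <= Rl])
  /\
  (forall c : constants R, admissible m H J c ->
     0 < R_lambda m c lambda /\
     forall (a b : \bar R) (q v : R -> 'M[R]_3),
       three_body_orbit m H J a b q v ->
       starts_in_component m H J (Istar c) b3 q v ->
       R_lambda m c lambda <= inertia m (q 0) ->
       exists t : R,
         [/\ (a < t%:E)%E, (t%:E < b)%E
           & inertia m (q t) <= R_lambda m c lambda]).
Proof.
split.
  have [Rl Rl0 h] := uniform_radius m_gt0 H_lt0 (J := J).
  by exists Rl => // a b q v orb _; exact: h orb.
move=> c adm; split; first exact: R_lambda_gt0 lambda_gt0 adm.
by move=> a b q v orb start _; exact: explicit_radius orb start.
Qed.
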